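(* Let $U:[0,\infty)\to[0,\infty)$ be a nondecreasing function with Laplace--Stieltjes transform $\widehat U(s)=\int_{[0,\infty)}e^{-sx}\,\mathrm{d}U(x)$, let $\rho\ge 0$, $r>1$, and let $\ell$ be slowly varying at infinity. Then the following two statements are equivalent: (a) there is some $p\in\mathcal{P}_r$ such that $$\lim_{n\to\infty}\frac{U(r^nz)}{(r^nz)^\rho\,\ell(r^nz)}=p(z)\quad\text{for each } z\in C_p;$$ (b) there is some $q\in\mathcal{P}_r$ such that $$\widehat U(s)\sim s^{-\rho}\,\ell(1/s)\,q(s)\quad\text{as } s\downarrow 0.$$ In each case, necessarily $p\in\mathcal{P}_{r,\rho}$, $q\in\mathcal{Q}_{r,\rho}$, and $q=\mathrm{A}_\rho p$ if $\rho>0$, while $p=q$ if $\rho=0$. Moreover, if (a) holds with a continuous $p$, then $$U(x)\sim x^\rho\,\ell(x)\,p(x)\quad\text{as } x\to\infty.$$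
   Context: A function $\ell:(0,\infty)\to(0,\infty)$ is slowly varying at infinity if it is measurable and $\ell(\lambda x)/\ell(x)\to1$ as $x\to\infty$ for every $\lambda>0$. The Laplace--Stieltjes integral is with respect to the measure on $[0,\infty)$ induced by $U$ with the convention $U(0-)=0$ (so the value of $U$ at $0$ contributes to an atom at $0$). For $r>1$, $\mathcal{P}_r$ is the set of functions $p:(0,\infty)\to(0,\infty)$ that are bounded, right-continuous, satisfy $\inf_{x\in[1,r]}p(x)>0$, and $p(xr)=p(x)$ for all $x>0$. $C_p$ is the set of continuity points of $p$. For $\rho\ge0$, $\mathcal{P}_{r,\rho}$ is the set of $p\in\mathcal{P}_r$ such that $x\mapsto x^\rho p(x)$ is nondecreasing. For $\rho\ge0$, $\mathcal{Q}_{r,\rho}$ is the set of functions $q:(0,\infty)\to(0,\infty)$ such that $s\mapsto s^{-\rho}q(s)$ is completely monotone on $(0,\infty)$ and $q(sr)=q(s)$ for all $s>0$. For $\rho=0$ both $\mathcal{P}_{r,0}$ and $\mathcal{Q}_{r,0}$ consist of the positive constant functions. For $\rho>0$ and $p\in\mathcal{P}_{r,\rho}$, $\mathrm{A}_\rho p(s)=s^\rho\int_0^\infty e^{-sx}\,\mathrm{d}(p(x)x^\rho)$, $s>0$. $f\sim g$ means $f/g\to1$. *)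

(* Defs.v *)
From HB Require Import structures.
From mathcomp Require Import all_boot all_order all_algebra.
From mathcomp Require Import all_classical all_reals all_analysis.

Set Implicit Arguments.
Unset Strict Implicit.
Unset Printing Implicit Defensive.
Import Order.TTheory GRing.Theory Num.Theory.
Import numFieldNormedType.Exports.
Local Open Scope classical_set_scope.
Local Open Scope ring_scope.

(* Functions on (0, oo) or [0, oo) are total functions R -> R of which only the
   values on that half-line are ever constrained or used. *)

Definition nondecreasing_nonneg (R : realType) (f : R -> R) : Prop :=
  {in `[0, +oo[ &, {homo f : x y / x <= y}} /\ 0 <= f 0.

(* Right-continuous version of f on [0, oo), extended by 0 on (-oo, 0); the jump
   at 0 encodes the convention f(0-) = 0.  Functions that are not nondecreasing
   and nonnegative on [0, oo) are sent to 0, so that rc_ext f is always a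
   distribution function. *)
Definition rc_ext (R : realType) (f : R -> R) (x : R) : R :=
  if `[< nondecreasing_nonneg f >] && (0 <= x) then lim (f y @[y --> x^'+])
  else 0.

Lemma cvg_right_inf (R : realType) (f : R -> R) (x : R) :
  nondecreasing_nonneg f -> 0 <= x ->
  f y @[y --> x^'+] --> inf (f @` `]x, +oo[).
Proof.
move=> [fnd f0] x0; apply: nondecreasing_at_right_cvgr => //.
  by move=> y z; rewrite !in_itv/= !andbT => xy xz; apply: fnd;
    rewrite in_itv/= andbT (le_trans x0)// ltW.
exists (f x) => _ [y/= + <-]; rewrite in_itv/= andbT => xy.
by apply: fnd; rewrite ?in_itv/= ?andbT ?(le_trans x0)// ltW.
Qed.

Lemma rc_extE (R : realType) (f : R -> R) (x : R) :
  nondecreasing_nonneg f -> 0 <= x -> rc_ext f x = inf (f @` `]x, +oo[).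
Proof.
move=> Hf x0; rewrite /rc_ext asboolT//= x0.
by apply: cvg_lim => //; exact: cvg_right_inf.
Qed.

Lemma rc_ext_le (R : realType) (f : R -> R) (x y : R) :
  nondecreasing_nonneg f -> 0 <= x -> x < y -> rc_ext f x <= f y.
Proof.
move=> Hf x0 xy; rewrite rc_extE//; apply: ge_inf.
  exists (f x) => _ [z/= + <-]; rewrite in_itv/= andbT => xz.
  by apply: Hf.1; rewrite ?in_itv/= ?andbT ?(le_trans x0)// ltW.
by exists y => //=; rewrite in_itv/= andbT.
Qed.

Lemma rc_ext_ge (R : realType) (f : R -> R) (x y : R) :
  nondecreasing_nonneg f -> 0 <= x -> x <= y -> f x <= rc_ext f y.
Proof.
move=> Hf x0 xy; rewrite rc_extE ?(le_trans x0)//; apply: lb_le_inf.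
  by exists (f (y + 1)); exists (y + 1) => //=; rewrite in_itv/= andbT ltrDl.
move=> _ [z/= + <-]; rewrite in_itv/= andbT => yz.
have xz : x <= z by rewrite (le_trans xy)// ltW.
by apply: Hf.1; rewrite ?in_itv/= ?andbT ?(le_trans x0).
Qed.

Lemma rc_ext_nd (R : realType) (f : R -> R) : nondecreasing (rc_ext f).
Proof.
move=> x y xy.
have [Hf|nHf] := pselect (nondecreasing_nonneg f); last first.
  by rewrite /rc_ext asboolF.
have [x0|x0] := leP 0 x; last first.
  rewrite {1}/rc_ext (lt_geF x0) andbF.
  have [y0|y0] := leP 0 y; last by rewrite /rc_ext (lt_geF y0) andbF.
  by rewrite (le_trans Hf.2)//; exact: rc_ext_ge.
rewrite le_eqVlt in xy; case/orP: xy => [/eqP->//|xy].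
by rewrite (le_trans (rc_ext_le Hf x0 xy))// rc_ext_ge// (le_trans x0)// ltW.
Qed.

Lemma rc_ext_rc (R : realType) (f : R -> R) : right_continuous (rc_ext f).
Proof.
move=> x.
have [Hf|nHf] := pselect (nondecreasing_nonneg f); last first.
  have -> : rc_ext f = cst 0 by apply/funext => z; rewrite /rc_ext asboolF.
  exact: cvg_cst.
have [x0|x0] := leP 0 x; last first.
  have -> : rc_ext f x = 0 by rewrite /rc_ext (lt_geF x0) andbF.
  apply: cvg_near_cst; near=> z.
  have z0 : z < 0 by near: z; exact: nbhs_right_lt.
  by rewrite /rc_ext (lt_geF z0) andbF.
have cf : f y @[y --> x^'+] --> rc_ext f x.
  by rewrite rc_extE//; exact: cvg_right_inf.
apply/cvgrPdist_lt => e e0.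
move/cvgrPdist_lt : cf => /(_ _ e0) [d/= d0 fd].
exists d => //= z xzd xz.
pose w := (z + (x + d)) / 2.
have zxd : z < x + d.
  by move: xzd; rewrite /= distrC ger0_norm ?subr_ge0 ?(ltW xz)// ltrBlDl.
have zw : z < w by rewrite /w midf_lt.
have wxd : w < x + d by rewrite /w midf_lt.
have xw : x < w := lt_trans xz zw.
have := fd w; rewrite /= distrC ger0_norm ?subr_ge0 ?(ltW xw)// ltrBlDl.
move=> /(_ wxd xw); rewrite distrC ger0_norm ?subr_ge0; last exact: rc_ext_le.
move=> fw; rewrite distrC ger0_norm ?subr_ge0; last by apply: rc_ext_nd; exact: ltW.
rewrite (le_lt_trans _ fw)// lerD2r rc_ext_le// (le_trans x0)// ltW//.
Unshelve. all: by end_near. Qed.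

HB.instance Definition _ (R : realType) (f : R -> R) :=
  isCumulative.Build R _ R (rc_ext f) (@rc_ext_nd R f) (@rc_ext_rc R f).

(* The integral is taken over [0, oo), atom at 0 included; it may be +oo. *)
Definition laplace_stieltjes (R : realType) (f : R -> R) (s : R) : \bar R :=
  (\int[lebesgue_stieltjes_measure (rc_ext f)]_(x in `[0%R, +oo[)
     (expR (- (s * x)))%:E)%E.

Definition slowly_varying (R : realType) (l : R -> R) : Prop :=
  [/\ forall x, 0 < x -> 0 < l x,
      measurable_fun (`]0, +oo[ : set R) l
    & forall lambda, 0 < lambda -> l (lambda * x) / l x @[x --> +oo] --> (1 : R)].

Definition calP (R : realType) (r : R) (p : R -> R) : Prop :=
  [/\ forall x, 0 < x -> 0 < p x,
      exists M, forall x, 0 < x -> p x <= M,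
      forall x, 0 < x -> p y @[y --> x^'+] --> p x,
      0 < inf (p @` `[1, r])
    & forall x, 0 < x -> p (x * r) = p x].

Definition continuity_points (R : realType) (p : R -> R) : set R :=
  [set z | 0 < z /\ {for z, continuous p}].

Definition calP_rho (R : realType) (r rho : R) (p : R -> R) : Prop :=
  calP r p /\
  {in `]0, +oo[ &, {homo (fun x => x `^ rho * p x) : x y / x <= y}}.

Definition completely_monotone (R : realType) (f : R -> R) : Prop :=
  forall (n : nat) (s : R), 0 < s ->
    derivable (derive1n n f) s 1 /\ 0 <= (-1) ^+ n * derive1n n f s.

Definition calQ_rho (R : realType) (r rho : R) (q : R -> R) : Prop :=
  [/\ forall s, 0 < s -> 0 < q s,
      completely_monotone (fun s => s `^ (- rho) * q s)
    & forall s, 0 < s -> q (s * r) = q s].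

(* For rho > 0 the integrator vanishes at 0 because powR 0 rho = 0, whatever the
   value p 0, so there is no atom at 0. *)
Definition opA (R : realType) (rho : R) (p : R -> R) (s : R) : \bar R :=
  ((s `^ rho)%:E * laplace_stieltjes (fun x => (p x * x `^ rho)%R) s)%E.

Definition log_periodic_growth (R : realType) (U l : R -> R) (r rho : R)
    (p : R -> R) : Prop :=
  forall z, continuity_points p z ->
    U (r ^+ n * z) / ((r ^+ n * z) `^ rho * l (r ^+ n * z)) @[n --> \oo] --> p z.

(* The ratio is taken in \bar R, so it forces the transform to be finite for all
   small s > 0. *)
Definition log_periodic_laplace (R : realType) (U l : R -> R) (rho : R)
    (q : R -> R) : Prop :=
  (laplace_stieltjes U s * ((s `^ (- rho) * l (1 / s) * q s)^-1)%:E)%E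
    @[s --> 0^'+] --> 1%E.

(* Main.v *)
(* For n = 0, 1, 2, ... put U_n(x) = U(r^n x) / ((r^n)^rho l(r^n)).  By slow
   variation, (a) says that U_n(x) converges to F(x) = x^rho p(x) at the
   continuity points of p, and (b) that the transforms of U_n converge to
   s^(-rho) q(s); the two are linked by the continuity theorem for Laplace
   transforms, and F(r x) = r^rho F(x) because U_n(r x) is U_(n+1)(x) up to a
   factor tending to r^rho.  Writing the Laplace-Stieltjes transform as
   s int_0^oo e^(-s x) U(x) dx reduces everything to Lebesgue integrals.

   (a) => (b) is dominated convergence: U(r^(n+1) z) <= r^m U(r^n z) eventually,
   so the U_n grow uniformly subexponentially.  Passing from the sequence r^n to
   continuous s needs the uniform convergence theorem for slowly varying
   functions (via Egorov) and the fact that monotone functions converging to a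
   continuous limit converge uniformly on compact sets.

   (b) => (a) is Karamata's argument: the integrals of P(e^(-x)) e^(-x) U_n(x)
   converge for every polynomial P, hence for every tent function; tents
   supported in [e^(-z), e^(-y)] squeeze U_n(y) and U_m(z) against each other
   for y < z, which forces convergence at the continuity points of the
   right-continuous limit. *)
From HB Require Import structures.
Require Import Defs.
From mathcomp Require Import all_boot all_order all_algebra.
From mathcomp Require Import all_classical all_reals all_analysis.
From mathcomp Require Import measurable_realfun ring lra.
Set Implicit Arguments.
Unset Strict Implicit.
Unset Printing Implicit Defensive.
Import Order.TTheory GRing.Theory Num.Theory.
Import numFieldNormedType.Exports.
Local Open Scope classical_set_scope.
Local Open Scope ring_scope.

(** * Right-continuous functions *)

Section RightContinuous.
Context {R : realType}.
Implicit Types (p f : R -> R) (x y z d : R).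

(** The growth condition speaks only at continuity points of [p], and x^rho p(x) is not monotone by
    assumption. Right continuity bridges the gap: it makes the discontinuities countable, hence
    Lebesgue null with dense complement. Limits of transforms therefore ignore them, and every
    relation found at continuity points extends to all points from the right. The monotonicity of F
    and the scaling relation of the constructed limit are both obtained in this way. In the
    direction from the transform, the limit is written down directly as an infimum of eventual upper
    bounds. For the relation between p and q, (a) gives (b) with an explicit function built from p,
    and two log-periodic functions that normalise the same transform agree, since both are constant
    along s / r^n. The passage from r^n to a continuous variable writes x = r^n u with 1 <= u <= r
    and asks for an error uniform in u. As [l] is not monotone, its ratio is split off and handled
    apart from the monotone factor. *)

Lemma right_isolated_countable (D : set R) :
  (forall x, D x -> exists2 d, 0 < d & forall y, x < y < x + d -> ~ D y) ->
  countable D.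
Proof.
move=> Diso.
(* To each point of [D] is attached a rational in the gap on its right. If u < v in [D] shared their
   rational, v would lie in the gap of u; so the choice is injective. *)
have /choice[g gP] x : exists q : rat,
    D x -> x < ratr q :> R /\ forall y, x < y -> y <= ratr q -> ~ D y.
  have [Dx|nDx] := pselect (D x); last by exists 0.
  have [d d0 dP] := Diso _ Dx.
  have /rat_in_itvoo[q] : x < x + d by rewrite ltrDl.
  rewrite in_itv/= => /andP[xq qd]; exists q => _; split => // y xy yq.
  by apply: dP; rewrite xy (le_lt_trans yq).
apply/countable_injP; exists (pickle \o g) => x y /set_mem Dx /set_mem Dy.
move=> /(pcan_inj pickleK) gxy.
have aux u v : D u -> D v -> g u = g v -> ~ (u < v).
  move=> Du Dv guv uv; have [_ /(_ v uv)] := gP _ Du; apply => //.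
  by rewrite guv; apply/ltW; exact: (gP _ Dv).1.
by case: (ltgtP x y) => // [/aux|/aux]; [move=> /(_ Dx Dy gxy)|move=> /(_ Dy Dx (esym gxy))].
Qed.

(* The points where p oscillates by at least 1/k are right isolated. *)
Lemma right_continuous_discontinuity_countable p :
  (forall x, 0 < x -> p y @[y --> x^'+] --> p x) ->
  countable [set x | 0 < x /\ ~ {for x, continuous p}].
Proof.
move=> prc.
pose D (k : nat) := [set x | 0 < x /\ forall d, 0 < d ->
  exists2 y, `|y - x| < d & k.+1%:R^-1 <= `|p y - p x|].
apply: (@sub_countable _ _ _ (\bigcup_k D k)); last first.
  apply: bigcup_countable => // k _; apply: right_isolated_countable => x [x0 _].
  have k0 : 0 < k.+1%:R^-1 / 2 :> R by rewrite divr_gt0.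
  have /cvgrPdist_lt/(_ _ k0)[d/= d0 dP] := prc _ x0.
  exists d => // y /andP[xy yxd] [y0].
  (* This radius keeps [z] in ]x, x + d[, where [p] stays within half of 1/(k+1) of [p x]; an
     oscillation of 1/(k+1) at [y] is then impossible. *)
  have m0 : 0 < Num.min (y - x) (x + d - y) by rewrite lt_min !subr_gt0 xy.
  move=> /(_ _ m0)[z]; rewrite lt_min => /andP[zy1 zy2].
  have xz : x < z by move: zy1; rewrite ltr_norml => /andP[+ _]; lra.
  have zd : z < x + d by move: zy2; rewrite ltr_norml => /andP[_]; lra.
  have P w : x < w -> w < x + d -> `|p x - p w| < k.+1%:R^-1 / 2.
    by move=> xw wd; apply: dP => //=; rewrite ltr_norml; apply/andP; split; lra.
  apply/negP; rewrite -ltNge.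
  have := P _ xz zd; have := P _ xy yxd.
  move: (k.+1%:R^-1 : R) => e.
  by rewrite !ltr_norml => /andP[? ?] /andP[? ?]; apply/andP; split; lra.
apply: subset_card_le => x [x0 /= npx]; apply: contrapT => nD; apply: npx.
apply/cvgrPdist_lt => e e0.
have [k ke] : exists k : nat, k.+1%:R^-1 < e.
  by have [N _ /(_ N (leqnn _)) ?] := near_infty_natSinv_lt (PosNum e0); exists N.
have : ~ D k x by move=> Dk; apply: nD; exists k.
move=> /not_andP[//|/existsNP[d /not_implyP[d0 dP]]].
exists d => // y /= yxd; rewrite ltNge; apply/negP => ey.
apply: dP; exists y; rewrite distrC//.
exact: le_trans (ltW ke) ey.
Qed.

Lemma countable_compl_dense (D : set R) a b : countable D -> a < b ->
  exists2 x, a < x < b & ~ D x.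
Proof.
move=> cD ab; apply: contrapT => H.
have : countable (`]a, b[%classic : set R).
  apply: (sub_countable _ cD); apply: subset_card_le => x /=.
  by rewrite in_itv/= => xab; apply: contrapT => nDx; apply: H; exists x.
move=> /countable_lebesgue_measure0; rewrite lebesgue_measure_itv/= lte_fin ab.
by move=> /eqP; rewrite -EFinB eqe subr_eq0 => /eqP ba; rewrite ba ltxx in ab.
Qed.

(** Points outside a countable set accumulate at [x] from the right, and right continuity of both
    sides carries the inequality to [x]. *)
Lemma right_continuous_le p f (D : set R) : countable D ->
  (forall x, 0 < x -> p y @[y --> x^'+] --> p x) ->
  (forall x, 0 < x -> f y @[y --> x^'+] --> f x) ->
  (forall x, 0 < x -> ~ D x -> p x <= f x) ->
  forall x, 0 < x -> p x <= f x.
Proof.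
move=> cD cp cf pf x x0; rewrite leNgt; apply/negP => fp.
pose e := (p x - f x) / 2.
have e0 : 0 < e by rewrite divr_gt0// subr_gt0.
have /cvgrPdist_lt/(_ _ e0)[d1/= d10 d1P] := cp _ x0.
have /cvgrPdist_lt/(_ _ e0)[d2/= d20 d2P] := cf _ x0.
have [||y /andP[xy yd] nDy] := @countable_compl_dense D x (x + Num.min d1 d2) => //.
  by rewrite ltrDl lt_min d10.
have y0 : 0 < y := lt_trans x0 xy.
have yx : `|x - y| < Num.min d1 d2.
  by rewrite distrC gtr0_norm ?subr_gt0// ltrBlDl.
move: yx; rewrite lt_min => /andP[/d1P + /d2P] => /(_ xy) + /(_ xy).
have := pf _ y0 nDy.
by rewrite /e !ltr_norml => ? /andP[? ?] /andP[? ?]; lra.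
Qed.

End RightContinuous.

(** * Lebesgue measure under scaling, and the Laplace-Stieltjes transform *)

Section LebesgueScaling.
Context {R : realType}.
Local Notation mu := (@lebesgue_measure R).

Lemma scale_preimage_itvoc (a x y : R) : 0 < a ->
  ( *%R a) @^-1` `]x, y] = `]a^-1 * x, a^-1 * y]%classic.
Proof.
move=> a0; apply/seteqP; split => z /=; rewrite !in_itv/=;
  by rewrite ltr_pdivrMl// ler_pdivlMl.
Qed.

Lemma measurable_scale (a : R) :
  measurable_fun setT ( *%R a : measurableTypeR R -> measurableTypeR R).
Proof. by apply: mulrl_measurable. Qed.

Definition pushforward_scale (a : R) :
    {measure set (measurableTypeR R) -> \bar R}.
Proof.
refine (pushforward mu ( *%R a : measurableTypeR R -> measurableTypeR R)).
exact: measurable_scale.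
Defined.

(** The right-hand side is a measure that agrees with Lebesgue measure on half-open intervals, and
    such a measure is unique. *)
Lemma lebesgue_measure_scale (a : R) (A : set R) : 0 < a -> measurable A ->
  (mu A = a%:E * mu ( ( *%R a) @^-1` A))%E.
Proof.
move=> a0 mA.
pose m := mscale (NngNum (ltW a0)) (pushforward_scale a).
rewrite (@lebesgue_measure_unique R m _ A mA)//.
move=> _ [[x y]] _ <-.
rewrite /m /mscale/= /pushforward/=.
rewrite [X in (_ = _ * lebesgue_measure X)%E](scale_preimage_itvoc x y a0).
rewrite !lebesgue_measure_itv/=.
rewrite !lte_fin ltr_pM2l ?invr_gt0//; case: ifPn => xy; last by rewrite mule0.
by rewrite -!EFinB -EFinM mulrBr !mulVKf ?gt_eqF.
Qed.

Lemma ge0_integral_scale (a : R) (f : R -> \bar R) : 0 < a ->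
  measurable_fun (`[0%R, +oo[ : set R) f -> (forall x, 0 <= x -> (0 <= f x)%E) ->
  (\int[mu]_(x in `[0%R, +oo[) f x =
   a%:E * \int[mu]_(x in `[0%R, +oo[) f (a * x)%R)%E.
Proof.
move=> a0 mf f0.
pose m := mscale (NngNum (ltW a0)) (pushforward_scale a).
rewrite (@eq_measure_integral _ _ _ _ m); last first.
  by move=> A mA _; exact: (lebesgue_measure_scale a0 mA).
rewrite ge0_integral_mscale//; last first.
  by move=> x /=; rewrite in_itv/= andbT; exact: f0.
rewrite ge0_integral_pushforward//; last first.
  by move=> x; rewrite inE/= in_itv/= andbT; exact: f0.
congr (_ * _)%E.
rewrite (_ : ( *%R a @^-1` `[0, +oo[) = `[0, +oo[%classic)//.
by apply/seteqP; split => z /=; rewrite !in_itv/= !andbT pmulr_rge0.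
Qed.

End LebesgueScaling.

(** * The Laplace-Stieltjes transform as an ordinary Laplace transform *)

Section LaplaceStieltjes.
Context {R : realType}.
Local Notation mu := (@lebesgue_measure R).
Implicit Types (f : R -> R) (s x y : R).

Definition laplace f s : \bar R :=
  (\int[mu]_(x in `[0%R, +oo[) (expR (- (s * x)) * f x)%:E)%E.

Lemma continuous_expRN s : continuous (fun x : R => expR (- (s * x))).
Proof.
move=> x; apply: continuous_comp; last exact: continuous_expR.
by apply: continuousN; apply: continuousM => //; exact: cst_continuous.
Qed.

Lemma measurable_expRN s (D : set R) :
  measurable D -> measurable_fun D (fun x : R => expR (- (s * x))).
Proof.
move=> mD; apply: measurable_funTS; apply: continuous_measurable_fun.
exact: continuous_expRN.
Qed.

Lemma is_derive_expRN s x :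
  is_derive x 1 (fun y : R => expR (- (s * y))) (- (s * expR (- (s * x)))).
Proof.
have H : is_derive x (1:R) (fun y : R => - (s * y)) (- s).
  by apply: is_derive_eq; rewrite /GRing.scale/= mulr1.
by have := @is_derive1_comp _ expR (fun y => - (s * y)) x _ _ (is_derive_expR _) H;
  rewrite mulrN mulrC.
Qed.

Lemma integral_expRN_tail s x : 0 < s ->
  (\int[mu]_(y in `[x, +oo[) (s * expR (- (s * y)))%:E = (expR (- (s * x)))%:E)%E.
Proof.
move=> s0.
have dF y : is_derive y 1 (fun y : R => - expR (- (s * y))) (s * expR (- (s * y))).
  by have := is_deriveN (is_derive_expRN s y); rewrite opprK.
rewrite (@ge0_continuous_FTC2y _ _ (fun y => - expR (- (s * y))) _ 0).
- by rewrite sub0e EFinN oppeK.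
- by move=> y _; rewrite mulr_ge0 ?expR_ge0 ?ltW.
- apply: continuous_subspaceT => y.
  by apply: (@cvgM R R); [exact: cvg_cst|exact: continuous_expRN].
- rewrite -oppr0; apply: cvgN.
  apply: (@cvg_comp _ _ _ (fun y => s * y) (fun y => expR (- y)) _ (pinfty_nbhs R)).
    exact: gt0_cvgMry.
  exact: cvgr_expR.
- by move=> y _; exact: ex_derive.
- by apply/cvg_at_right_filter; apply: cvgN; exact: continuous_expRN.
- by move=> y _; rewrite derive1E; exact: derive_val.
Qed.

Lemma nondecreasing_nonneg_measurable f : nondecreasing_nonneg f ->
  measurable_fun (`[0%R, +oo[ : set R) f.
Proof.
move=> [fnd _]; apply: (eq_measurable_fun (fun x => f (Num.max 0 x))).
  by move=> x; rewrite inE/= in_itv/= andbT => x0; rewrite max_r.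
apply: nondecreasing_measurable => // x y xy; apply: fnd.
- by rewrite in_itv/= andbT le_max lexx.
- by rewrite in_itv/= andbT le_max lexx.
- by rewrite ge_max !le_max lexx/= xy orbT.
Qed.

(** For y < x one has [rc_ext f y <= f x <= rc_ext f x], so the two functions agree wherever
    [rc_ext f] is continuous. This lets [f] itself replace the distribution function under a
    Lebesgue integral. *)
Lemma rc_ext_ae f : nondecreasing_nonneg f ->
  ae_eq mu (`[0%R, +oo[%classic : set R) (EFin \o rc_ext f) (EFin \o f).
Proof.
move=> Hf.
have cD : countable [set x | 0 < x /\ ~ {for x, continuous (rc_ext f)}].
  by apply: right_continuous_discontinuity_countable => x _; exact: rc_ext_rc.
exists ([set 0] `|` [set x | 0 < x /\ ~ {for x, continuous (rc_ext f)}]).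
have cD0 : countable ([set 0] `|` [set x | 0 < x /\ ~ {for x, continuous (rc_ext f)}]).
  rewrite -bigcup2E; apply: bigcup_countable => // -[|[|n]] _ //=.
split.
- exact: countable_measurable.
- exact: countable_lebesgue_measure0.
move=> x /= /not_implyP[]; rewrite in_itv/= andbT le_eqVlt => /orP[/eqP<-|x0 nf].
  by left.
right; split => // cx; apply: nf; congr EFin.
apply/eqP; rewrite eq_le (rc_ext_ge Hf (ltW x0) (lexx x)) andbT leNgt; apply/negP => fx.
have e0 : 0 < rc_ext f x - f x by rewrite subr_gt0.
have /cvgrPdist_lt/(_ _ e0)[d/= d0 dP] := cx.
(* The bound [x / 2] keeps [y] nonnegative, as [rc_ext_le] requires; [x - d / 2] keeps it within [d]
   of [x]. *)
pose y := Num.max (x / 2) (x - d / 2).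
have yx : y < x by rewrite gt_max; apply/andP; split; lra.
have y0 : 0 <= y by rewrite le_max; apply/orP; left; lra.
have xyd : `|x - y| < d.
  by rewrite gtr0_norm ?subr_gt0// ltrBlDr -ltrBlDl lt_max; apply/orP; right; lra.
have := dP _ xyd; rewrite ltr_norml => /andP[_].
have := rc_ext_le Hf y0 yx; lra.
Qed.

Lemma lebesgue_stieltjes_itvoc f x y : x <= y ->
  lebesgue_stieltjes_measure (rc_ext f) `]x, y]%classic =
  (rc_ext f y - rc_ext f x)%:E.
Proof.
rewrite /lebesgue_stieltjes_measure/= /measure_extension measurable_mu_extE/=; last exact: is_ocitv.
exact: wlength_itv_bnd.
Qed.

Lemma rc_ext_lt0 f x : x < 0 -> rc_ext f x = 0.
Proof. by move=> x0; rewrite /rc_ext leNgt x0 andbF. Qed.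

(** The measure is known on intervals open at the left, so [0, y] is reached from ]-1, y] by
    removing ]-1, 0[, which is null because [rc_ext f] vanishes on the negative axis. The atom at 0
    is thereby counted. *)
Lemma lebesgue_stieltjes_itv0c f y : 0 <= y ->
  lebesgue_stieltjes_measure (rc_ext f) `[0, y]%classic = (rc_ext f y)%:E.
Proof.
move=> y0; set m := lebesgue_stieltjes_measure _.
have mN : m `]-1, 0[%classic = 0.
  rewrite (_ : `]-1, 0[%classic = \bigcup_k `](-1), (- k.+1%:R^-1)]%classic); last first.
    apply/seteqP; split=> [x/=|x [k _]/=]; rewrite !in_itv/= => /andP[x1 x0].
      have x0' : 0 < - x by rewrite oppr_gt0.
      have [N _ /(_ N (leqnn _)) /= NP] := near_infty_natSinv_lt (PosNum x0').
      by exists N => //=; rewrite in_itv/= x1 lerNr ltW.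
    by rewrite x1 (le_lt_trans x0)// oppr_lt0 invr_gt0.
  apply/negligibleP; first by apply: bigcup_measurable => *; exact: measurable_itv.
  apply: negligible_bigcup => k; apply/negligibleP; first exact: measurable_itv.
  rewrite /= lebesgue_stieltjes_itvoc; last by rewrite lerN2 invf_le1 ?ltr0n// ler1n.
  by rewrite !rc_ext_lt0 ?subrr// oppr_lt0 ?invr_gt0.
have <- : m `]-1, y]%classic = (rc_ext f y)%:E.
  by rewrite /m lebesgue_stieltjes_itvoc ?(@rc_ext_lt0 _ (-1)) ?subr0 ?oppr_lt0//
    (le_trans _ y0)// lerN10.
rewrite (_ : `]-1, y]%classic = `]-1, 0[%classic `|` `[0, y]%classic); last first.
  by rewrite -itv_bndbnd_setU// bnd_simp ?lerN10.
rewrite [RHS](@measureU _ _ _ m)//; try exact: measurable_itv.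
  by rewrite [X in (X + _)%E]mN add0e.
by apply/seteqP; split => // x [] /=; rewrite !in_itv/= => /andP[_ x0] /andP[]; rewrite leNgt x0.
Qed.

(** Tonelli on the region 0 <= x <= y: exp(-s x) is the integral of s exp(-s y) over y >= x, while
    the section at fixed y is [0, y], of Stieltjes measure [rc_ext f y]. *)
Lemma laplace_stieltjesE f s : nondecreasing_nonneg f -> 0 < s ->
  laplace_stieltjes f s = (s%:E * laplace f s)%E.
Proof.
move=> Hf s0; rewrite /laplace_stieltjes.
pose h (z : measurableTypeR R * measurableTypeR R) :=
  (if (0 <= z.1) && (z.1 <= z.2) then s * expR (- (s * z.2)) else 0)%:E : \bar R.
have mh : measurable_fun setT h.
  apply/measurable_EFinP; apply: measurable_fun_ifT => //=.
    apply: measurable_and.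
      apply: (@measurable_fun_ler _ _ R _ (fun=> 0) fst) => //; exact: measurable_fst.
    apply: (@measurable_fun_ler _ _ R _ fst snd); [exact: measurable_fst|exact: measurable_snd].
  apply: measurable_funM => //=.
  apply: (measurableT_comp (@measurable_expRN s setT measurableT)).
  exact: measurable_snd.
have h0 z : (0%R <= h z)%E.
  by rewrite /h lee_fin; case: ifP => // _; rewrite mulr_ge0 ?expR_ge0 ?ltW.
set m := lebesgue_stieltjes_measure _.
transitivity (\int[m]_x \int[mu]_y h (x, y))%E.
  rewrite integral_mkcond; apply: eq_integral => x _.
  rewrite patchE; case: ifPn; rewrite ?(inE,notin_setE)/= in_itv/= andbT => x0.
    rewrite -integral_expRN_tail// integral_mkcond; apply: eq_integral => y _.
    rewrite patchE /h/= x0/=; case: ifPn; rewrite ?(inE,notin_setE)/= in_itv/= andbT.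
      by move=> ->.
    by move=> /negP/negbTE ->.
  rewrite integral0_eq// => y _; rewrite /h/=.
  by move/negP/negbTE : x0 => ->.
rewrite fubini_tonelli//.
transitivity (\int[mu]_(y in `[0%R, +oo[) (s * expR (- (s * y)) * rc_ext f y)%:E)%E.
  rewrite [RHS]integral_mkcond; apply: eq_integral => y _.
  rewrite patchE; case: ifPn; rewrite ?(inE,notin_setE)/= in_itv/= andbT => y0.
    transitivity (\int[m]_x ((s * expR (- (s * y)))%:E * (\1_(`[0%R, y]%classic) x)%:E))%E.
      apply: eq_integral => x _; rewrite indicE /h/= mem_setE/= in_itv/=.
      by case: ifPn; rewrite ?mule1 ?mule0.
    rewrite ge0_integralZl_EFin//=; last 2 first.
      by apply/measurable_EFinP; apply: measurable_indic; exact: measurable_itv.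
      by rewrite mulr_ge0 ?expR_ge0 ?ltW.
    rewrite integral_indic//=.
    by rewrite setIT [X in (_ * X)%E]lebesgue_stieltjes_itv0c// -EFinM.
  rewrite integral0_eq// => x _; rewrite /h/=; case: ifP => // /andP[x0 xy].
  by exfalso; apply: y0; exact: le_trans xy.
rewrite /laplace -ge0_integralZl_EFin//=; last 3 first.
  move=> x; rewrite in_itv/= andbT => x0; rewrite lee_fin mulr_ge0 ?expR_ge0//.
  by rewrite (le_trans Hf.2)// Hf.1// in_itv/= ?lexx ?x0.
  apply/measurable_EFinP; apply: measurable_funM; first exact: measurable_expRN.
  exact: nondecreasing_nonneg_measurable.
  exact: ltW.
apply: ae_eq_integral => //=.
- apply/measurable_EFinP; apply: measurable_funM.
    by apply: measurable_funM => //; exact: measurable_expRN.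
  by apply: nondecreasing_measurable => //; exact: rc_ext_nd.
- apply/measurable_EFinP; apply: measurable_funM => //; apply: measurable_funM.
    exact: measurable_expRN.
  exact: nondecreasing_nonneg_measurable.
apply: filterS (rc_ext_ae Hf) => x /= + x0 => /(_ x0) [->].
by rewrite -EFinM mulrA.
Qed.

End LaplaceStieltjes.

(** * Uniform convergence of slowly varying functions *)

Section SlowlyVarying.
Context {R : realType}.
Local Notation mu := (@lebesgue_measure R).

Lemma uniform_cvg_dist (f : (R -> R)^nat) (g : R -> R) (A : set R) (e : R) :
  {uniform A, f @ \oo --> g} -> 0 < e ->
  \forall n \near \oo, forall y, A y -> `|g y - f n y| < e.
Proof.
move=> fg e0; apply: (fg [set h | forall y, A y -> ball (g y) e (h y)]).
rewrite uniform_nbhs.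
exists [set xy : R * R | ball xy.1 e xy.2]; split; first exact: (entourage_ball _ (PosNum e0)).
by move=> h /= hP y Ay; exact: hP.
Qed.

Lemma almost_uniform (f : (R -> R)^nat) (A : set R) (eta : R) :
  (forall n, measurable_fun A (f n)) -> measurable A -> (mu A < +oo)%E ->
  (forall y, A y -> f ^~ y @ \oo --> (1 : R)) -> 0 < eta ->
  exists B : set R, [/\ measurable B, (mu B < eta%:E)%E &
    forall d, 0 < d ->
      \forall n \near \oo, forall y, A y -> ~ B y -> `|1 - f n y| < d].
Proof.
move=> mf mA Afin f1 eta0.
have [B [mB Beta uB]] := @pointwise_almost_uniform _ _ _ mu f (fun=> 1) A eta mf mA Afin f1 eta0.
exists B; split => // d d0.
have := uniform_cvg_dist uB d0.
by apply: filterS => n nP y Ay nBy; apply: nP.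
Qed.

Lemma slowly_varying_measurable (l : R -> R) (c : R) (A : set R) :
  slowly_varying l -> 0 < c -> measurable A -> A `<=` [set y | 0 < y] ->
  measurable_fun A (fun y => l (y * c) / l c).
Proof.
move=> [_ ml _] c0 mA A0; apply: measurable_funM => //.
apply: (measurable_comp _ _ ml) => //.
  move=> _ [y Ay <-]; rewrite /= in_itv/= andbT mulr_gt0//; exact: A0.
by apply: measurable_funTS; exact: mulrr_measurable.
Qed.

(* If u_n in [1, B] violated the conclusion along x_n, then by Egorov both
   l (y x_n) / l x_n and l (y u_n x_n) / l (u_n x_n) would be close to 1 for most y
   in [1, B + 1]; for a suitable y in [B, B + 1], the former at y and the latter
   at y / u_n have l (u_n x_n) / l x_n as quotient. *)
Lemma slowly_varying_uniform (l : R -> R) (B e : R) :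
  slowly_varying l -> 1 <= B -> 0 < e ->
  \forall x \near +oo, forall u, 1 <= u <= B -> `|l (u * x) / l x - 1| < e.
Proof.
move=> sl B1 e0; have [l0 ml lcvg] := sl; apply: contrapT => H.
have /choice[xu xuP] (n : nat) : exists xu : R * R,
    [/\ n.+1%:R <= xu.1, 1 <= xu.2 <= B & e <= `|l (xu.2 * xu.1) / l xu.1 - 1|].
  apply: contrapT => /forallNP Hn; apply: H.
  apply: filterS (nbhs_pinfty_ge (num_real n.+1%:R)) => x nx u uB.
  by rewrite ltNge; apply/negP => ex; apply: (Hn (x, u)); split.
pose x n := (xu n).1; pose u n := (xu n).2.
have x0 n : 0 < x n by have [+ _ _] := xuP n; apply: lt_le_trans; rewrite ltr0n.
have u1 n : 1 <= u n by have [_ /andP[]] := xuP n.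
have u0 n : 0 < u n := lt_le_trans ltr01 (u1 n).
have uB n : u n <= B by have [_ /andP[]] := xuP n.
have ux0 n : 0 < u n * x n by rewrite mulr_gt0.
have xoo : x n @[n --> \oo] --> +oo.
  apply/cvgryPge => M; near=> n; have [+ _ _] := xuP n; apply: le_trans.
  apply: (@le_trans _ _ n%:R); last by rewrite ler_nat.
  by near: n; exact: nbhs_infty_ger.
have uxoo : u n * x n @[n --> \oo] --> +oo.
  apply: (@ger_cvgy _ _ _ _ x) => //; apply: nearW => n.
  by rewrite ler_peMl// ltW.
(* Large enough to contain both y and y / u_n when y is in [B, B + 1] and u_n in [1, B]. *)
pose A := `[1, B + 1]%classic : set R.
have mA : measurable A by exact: measurable_itv.
have Afin : (mu A < +oo)%E.
  by rewrite lebesgue_measure_itv/=; case: ifP => // _; rewrite -EFinB ltry.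
have A0 : A `<=` [set y | 0 < y].
  by move=> y; rewrite /A/= in_itv/= => /andP[+ _]; exact: lt_le_trans.
have lim1 (c : nat -> R) : c n @[n --> \oo] --> +oo ->
    forall y, A y -> l (y * c n) / l (c n) @[n --> \oo] --> (1 : R).
  by move=> coo y /A0 y0; exact: (cvg_comp _ _ coo (lcvg _ y0)).
(* The exceptional sets to be avoided are the first Egorov set and the second one dilated by u_n <=
   B. Together they measure less than (1 + B) eta = 1/2, so they cannot cover [B, B + 1]. *)
pose eta := (2 * (1 + B))^-1.
have B0 : 0 < B := lt_le_trans ltr01 B1.
have eta0 : 0 < eta by rewrite invr_gt0 mulr_gt0// addr_gt0.
have [B1' [mB1 B1eta B1u]] := almost_uniform
  (fun n => slowly_varying_measurable sl (x0 n) mA A0) mA Afin (lim1 _ xoo) eta0.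
have [B2 [mB2 B2eta B2u]] := almost_uniform
  (fun n => slowly_varying_measurable sl (ux0 n) mA A0) mA Afin (lim1 _ uxoo) eta0.
(* If p and q are within [d] of 1, then q > 1/2 and |p / q - 1| < 2 d / q < 4 d <= e. *)
pose d := Num.min (1 / 2) (e / 4).
have d0 : 0 < d by rewrite lt_min !divr_gt0.
have [n [P1 P2]] : exists n, (forall y, A y -> ~ B1' y -> `|1 - l (y * x n) / l (x n)| < d) /\
    (forall y, A y -> ~ B2 y -> `|1 - l (y * (u n * x n)) / l (u n * x n)| < d).
  near \oo => n; exists n; split.
    by near: n; exact: B1u.
  by near: n; exact: B2u.
have [y [yB1 yB2 ny1 ny2]] : exists y, [/\ B <= y, y <= B + 1, ~ B1' y & ~ B2 ((u n)^-1 * y)].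
  apply: contrapT => Hn.
  pose B2' := *%R (u n)^-1 @^-1` B2.
  have mB2' : measurable (B2' : set R).
    by rewrite /B2' -[X in measurable X]setTI; exact: measurable_scale.
  pose C := `[B, B + 1]%classic : set R.
  have sub : C `<=` B1' `|` B2'.
    move=> y; rewrite /C/= in_itv/= => /andP[yB yB']; apply: contrapT => /not_orP[? ?].
    by apply: Hn; exists y.
  have : (mu C <= mu (B1' `|` B2'))%E.
    by apply: le_measure => //; rewrite inE//; [exact: measurable_itv|exact: measurableU].
  apply/negP; rewrite -ltNge.
  rewrite /C lebesgue_measure_itv/= lte_fin ltrDl ltr01 -EFinB addrAC subrr add0r.
  apply: (le_lt_trans (measureU2 _ _ _)) => //.
  have un0 : 0 < (u n)^-1 by rewrite invr_gt0.
  have mB2E : mu B2' = ((u n)%:E * mu B2)%E.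
    have un0' : u n != 0 by rewrite gt_eqF.
    by rewrite (lebesgue_measure_scale un0 mB2) muleA -EFinM divff// mul1e.
  rewrite [X in (_ + X)%E]mB2E.
  have : (mu B1' + (u n)%:E * mu B2 < eta%:E + B%:E * eta%:E)%E.
    apply: lte_leD => //; first by rewrite fin_numM// ge0_fin_numE// (lt_trans B2eta)// ltry.
    apply: (@le_trans _ _ (B%:E * mu B2)%E).
      by apply: lee_wpmul2r => //; rewrite lee_fin.
    by apply: lee_wpmul2l; rewrite ?lee_fin ltW.
  move=> /lt_le_trans; apply; rewrite -EFinM -EFinD lee_fin.
  rewrite -{1}[eta]mul1r -mulrDl /eta ler_pdivrMr ?mulr_gt0 ?addr_gt0// mul1r.
  by rewrite ler_peMl ?ler1n// ltW// addr_gt0.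
have Ay : A y by rewrite /A/= in_itv/= yB2 andbT (le_trans B1).
have Ayu : A ((u n)^-1 * y).
  rewrite /A/= in_itv/= ler_pdivlMl// mulr1 (le_trans (uB n))//=.
  by rewrite ler_pdivrMl// (le_trans yB2)// ler_peMl// addr_ge0// ltW.
have := P1 _ Ay ny1; have := P2 _ Ayu ny2.
have [_ _] := xuP n; rewrite -/(x n) -/(u n).
have -> : (u n)^-1 * y * (u n * x n) = y * x n.
  by field; exact: lt0r_neq0 (u0 n).
have lx := l0 _ (x0 n); have lux := l0 _ (ux0 n).
have ly : 0 < l (y * x n) by apply: l0; rewrite mulr_gt0//; exact: A0.
move: lx lux ly; move: (l (x n)) (l (u n * x n)) (l (y * x n)) => a b c a0 b0 c0.
have -> : b / a = (c / a) / (c / b) by field; rewrite !gt_eqF.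
move: (c / a) (c / b) (divr_gt0 c0 b0) => p q q0.
move=> ep; rewrite !ltr_norml => /andP[q1 q2] /andP[p1 p2].
have d2 : d <= 1 / 2 by rewrite ge_min lexx.
have d4 : d <= e / 4 by rewrite ge_min lexx orbT.
move: ep; apply/negP; rewrite -ltNge.
have -> : p / q - 1 = (p - q) / q by field; rewrite gt_eqF.
rewrite normrM normfV (gtr0_norm q0) ltr_pdivrMr//.
apply: (@lt_le_trans _ _ (2 * d)); first by rewrite ltr_norml; apply/andP; split; lra.
nra.
Unshelve. all: by end_near. Qed.

End SlowlyVarying.

(** * Laplace transforms of nondecreasing functions *)

(* Locked: otherwise failed unifications unfold the integrals. *)
HB.lock Definition real_laplace {R : realType} (f : R -> R) (t : R) : R :=
  fine (laplace f t).
Canonical real_laplace_unlockable := Unlockable real_laplace.unlock.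

Section LaplaceTransform.
Context {R : realType}.
Local Notation mu := (@lebesgue_measure R).
Implicit Types (f g F : R -> R) (s t x y : R).

Lemma nondecreasing_nonneg_ge0 f x : nondecreasing_nonneg f -> 0 <= x -> 0 <= f x.
Proof.
move=> [fnd f0] x0; apply: (le_trans f0); apply: fnd => //;
  by rewrite in_itv/= ?lexx ?x0.
Qed.

Lemma nondecreasing_nonneg_le f x y : nondecreasing_nonneg f ->
  0 <= x -> x <= y -> f x <= f y.
Proof.
move=> [fnd f0] x0 xy; apply: fnd => //;
  by rewrite in_itv/= andbT// (le_trans x0).
Qed.

Lemma measurable_laplace f t : nondecreasing_nonneg f ->
  measurable_fun (`[0%R, +oo[ : set R) (fun x => (expR (- (t * x)) * f x)%:E).
Proof.
move=> Hf; apply/measurable_EFinP; apply: measurable_funM.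
  exact: measurable_expRN.
exact: nondecreasing_nonneg_measurable.
Qed.

Lemma laplace_integrand_ge0 f t x : nondecreasing_nonneg f -> x \in `[0, +oo[ ->
  0 <= expR (- (t * x)) * f x.
Proof.
move=> Hf; rewrite in_itv/= andbT => x0; rewrite mulr_ge0 ?expR_ge0//.
exact: nondecreasing_nonneg_ge0.
Qed.

Lemma laplace_ge0 f t : nondecreasing_nonneg f -> (0 <= laplace f t)%E.
Proof.
by move=> Hf; apply: integral_ge0 => x x0; rewrite lee_fin laplace_integrand_ge0.
Qed.

Lemma laplace_nonincreasing f s t : nondecreasing_nonneg f -> s <= t ->
  (laplace f t <= laplace f s)%E.
Proof.
move=> Hf st; apply: ge0_le_integral => //=.
- by move=> x x0; rewrite lee_fin laplace_integrand_ge0.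
- exact: measurable_laplace.
- exact: measurable_laplace.
move=> x; rewrite in_itv/= andbT => x0.
rewrite lee_fin ler_wpM2r ?nondecreasing_nonneg_ge0//.
by rewrite ler_expR lerN2 ler_wpM2r.
Qed.

Lemma nondecreasing_nonneg_scale f a c : nondecreasing_nonneg f ->
  0 <= a -> 0 <= c -> nondecreasing_nonneg (fun x => c * f (a * x)).
Proof.
move=> Hf a0 c0; split; last by rewrite mulr0 mulr_ge0 ?Hf.2.
move=> x y; rewrite !in_itv/= !andbT => x0 y0 xy; rewrite ler_wpM2l//.
by apply: nondecreasing_nonneg_le; rewrite ?mulr_ge0 ?ler_wpM2l.
Qed.

Lemma laplace_scale f a c t : nondecreasing_nonneg f -> 0 < a -> 0 <= c ->
  laplace (fun x => c * f (a * x)) t = ((c / a)%:E * laplace f (t / a))%E.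
Proof.
move=> Hf a0 c0.
have Ha : nondecreasing_nonneg (fun x => f (a * x)).
  by have := nondecreasing_nonneg_scale Hf (ltW a0) ler01; under eq_fun do rewrite mul1r.
rewrite /laplace [in RHS](ge0_integral_scale a0); last 2 first.
- exact: measurable_laplace.
- by move=> x x0; rewrite lee_fin laplace_integrand_ge0// in_itv/= x0.
rewrite muleA -EFinM divfK ?gt_eqF// -ge0_integralZl_EFin//; last 2 first.
- move=> x; rewrite /= in_itv/= andbT => x0.
  by rewrite lee_fin laplace_integrand_ge0// in_itv/= andbT mulr_ge0// ltW.
- rewrite (_ : (fun x => _) = (fun x => (expR (- (t * x)) * f (a * x))%:E)); last first.
    by apply/funext => x; rewrite mulrA divfK ?gt_eqF.
  exact: measurable_laplace.
by apply: eq_integral => x _; rewrite -EFinM (mulrA (t / a)) divfK ?gt_eqF// mulrCA.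
Qed.

(** On [x, oo[ the function is at least [f x], and d exp(-d y) has mass exp(-d x) there. A bound on
    the transform thus becomes a pointwise exponential bound on the function. *)
Lemma laplace_tail_bound f d x : nondecreasing_nonneg f -> 0 < d -> 0 <= x ->
  ((f x * expR (- (d * x)))%:E <= d%:E * laplace f d)%E.
Proof.
move=> Hf d0 x0.
rewrite EFinM -integral_expRN_tail// -ge0_integralZl_EFin//; last 3 first.
- by move=> y _; rewrite lee_fin mulr_ge0 ?expR_ge0 ?ltW.
- by apply/measurable_EFinP; apply: measurable_funM => //; exact: measurable_expRN.
- exact: nondecreasing_nonneg_ge0.
rewrite /laplace -ge0_integralZl_EFin//; last 3 first.
- by move=> y y0; rewrite lee_fin laplace_integrand_ge0.
- exact: measurable_laplace.
- exact: ltW.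
have sub : (`[x, +oo[%classic : set R) `<=` `[0, +oo[%classic.
  by move=> y; rewrite /= !in_itv/= !andbT; exact: le_trans.
pose Y := (\int[mu]_(y in `[x, +oo[) (d%:E * (expR (- (d * y)) * f y)%:E))%E.
apply: (@le_trans _ _ Y).
  apply: ge0_le_integral => //=.
  - by move=> y _; rewrite -EFinM lee_fin mulr_ge0 ?(nondecreasing_nonneg_ge0 Hf)//
      mulr_ge0 ?expR_ge0 ?ltW.
  - apply/measurable_EFinP; apply: measurable_funM => //.
    by apply: measurable_funM => //; exact: measurable_expRN.
  - apply: emeasurable_funM => //.
    by apply: measurable_funS (measurable_laplace _ Hf).
  move=> y; rewrite in_itv/= andbT => xy; rewrite -!EFinM lee_fin mulrCA.
  rewrite ler_wpM2l ?(ltW d0)// mulrC ler_wpM2l ?expR_ge0//.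
  exact: nondecreasing_nonneg_le.
apply: ge0_subset_integral => //=.
- by apply: emeasurable_funM => //; exact: measurable_laplace.
- by move=> y y0; rewrite -EFinM lee_fin mulr_ge0 ?(ltW d0)// laplace_integrand_ge0.
Qed.

Lemma integrable_expRN d : 0 < d ->
  mu.-integrable `[0, +oo[ (fun x => (expR (- (d * x)))%:E).
Proof.
move=> d0; apply/integrableP; split.
  by apply/measurable_EFinP; exact: measurable_expRN.
under eq_integral do rewrite gee0_abs ?lee_fin ?expR_ge0//.
have -> : (\int[mu]_(x in `[0%R, +oo[) (expR (- (d * x)))%:E = (d^-1)%:E)%E.
  have := integral_expRN_tail 0 d0; rewrite mulr0 oppr0 expR0.
  under eq_integral do rewrite EFinM.
  rewrite ge0_integralZl_EFin//=; last 2 first.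
    by apply/measurable_EFinP; exact: measurable_expRN.
    exact: ltW.
  move=> /(congr1 (fun z => (d^-1)%:E * z)%E).
  by rewrite muleA -EFinM mulVf ?gt_eqF// mul1e mule1.
exact: ltry.
Qed.

Lemma integrable_laplace_bound f C d t : nondecreasing_nonneg f -> d < t ->
  (forall x, 0 <= x -> f x <= C * expR (d * x)) ->
  mu.-integrable `[0, +oo[ (fun x => (expR (- (t * x)) * f x)%:E).
Proof.
move=> Hf dt fC.
have td : 0 < t - d by rewrite subr_gt0.
pose g x := (C%:E * (expR (- ((t - d) * x)))%:E)%E.
apply: (@le_integrable _ _ _ mu _ _ _ g) => //=.
- exact: measurable_laplace.
- move=> x; rewrite in_itv/= andbT => x0; rewrite /= lee_fin ger0_norm; last first.
    by rewrite laplace_integrand_ge0// in_itv/= x0.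
  apply: (le_trans _ (ler_norm _)).
  rewrite mulrC (_ : - ((t - d) * x) = d * x + - (t * x)); last by ring.
  by rewrite expRD mulrA ler_wpM2r ?expR_ge0// fC.
- by apply: integrableZl => //; exact: integrable_expRN.
Qed.

Definition laplace_finite f := forall t, 0 < t -> (laplace f t < +oo)%E.

Lemma laplace_finite_integrable f t : nondecreasing_nonneg f ->
  laplace_finite f -> 0 < t ->
  mu.-integrable `[0, +oo[ (fun x => (expR (- (t * x)) * f x)%:E).
Proof.
move=> Hf ff t0; apply/integrableP; split; first exact: measurable_laplace.
rewrite [ltLHS](_ : _ = laplace f t); first exact: ff.
apply: eq_integral => x; rewrite inE => x0.
by rewrite gee0_abs// lee_fin laplace_integrand_ge0.
Qed.

Lemma real_laplaceE f t : nondecreasing_nonneg f -> laplace_finite f -> 0 < t ->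
  (real_laplace f t)%:E = laplace f t.
Proof.
by move=> Hf ff t0; rewrite unlock fineK// ge0_fin_numE ?laplace_ge0// ff.
Qed.

Lemma real_laplace_nonincreasing f s t : nondecreasing_nonneg f ->
  laplace_finite f -> 0 < s -> s <= t -> real_laplace f t <= real_laplace f s.
Proof.
move=> Hf ff s0 st; have t0 := lt_le_trans s0 st.
by rewrite -lee_fin !real_laplaceE//; exact: laplace_nonincreasing.
Qed.

Lemma cvg_real_laplace (V : nat -> R -> R) f t : nondecreasing_nonneg f ->
  laplace_finite f -> 0 < t -> laplace (V n) t @[n --> \oo] --> laplace f t ->
  real_laplace (V n) t @[n --> \oo] --> real_laplace f t.
Proof.
by move=> Hf ff t0; rewrite -(real_laplaceE Hf ff t0) => /fine_cvg; rewrite unlock.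
Qed.

Definition subexponential (V : nat -> R -> R) := forall d, 0 < d ->
  exists C, \forall n \near \oo, forall x, 0 <= x -> V n x <= C * expR (d * x).

(** Domination at rate t/2 leaves the integrable majorant C exp(-t x / 2). It holds only from some
    index [N] on, whence the shifted sequence in the proof; [D] and 0 form a null set. *)
Lemma cvg_laplace (V : nat -> R -> R) F (D : set R) t :
  (forall n, nondecreasing_nonneg (V n)) -> nondecreasing_nonneg F ->
  subexponential V -> countable D ->
  (forall x, 0 < x -> ~ D x -> V n x @[n --> \oo] --> F x) -> 0 < t ->
  mu.-integrable `[0, +oo[ (fun x => (expR (- (t * x)) * F x)%:E) /\
  laplace (V n) t @[n --> \oo] --> laplace F t.
Proof.
move=> HV HF subV cD VF t0.
have t20 : 0 < t / 2 by rewrite divr_gt0.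
have [C [N _ NC]] := subV _ t20.
have mI : measurable (`[0, +oo[%classic : set R) by [].
pose h n x := (expR (- (t * x)) * V (n + N)%N x)%:E.
have [| | | | |iF _ cF] := @dominated_convergence _ _ _ mu _ mI h
  (fun x => (expR (- (t * x)) * F x)%:E) (fun x => (C%:E * (expR (- ((t / 2) * x)))%:E)%E).
- by move=> n; exact: measurable_laplace.
- exact: measurable_laplace.
- have cD0 : countable ([set 0] `|` D).
    by rewrite -bigcup2E; apply: bigcup_countable => // -[|[|n]] _ //=.
  exists ([set 0] `|` D); split.
  + exact: countable_measurable.
  + exact: countable_lebesgue_measure0.
  move=> x /= /not_implyP[]; rewrite in_itv/= andbT le_eqVlt => /orP[/eqP<-|x0 nf].
    by left.
  right; apply: contrapT => nDx; apply: nf; apply: cvg_EFin; first exact: nearW.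
  apply: cvgM; first exact: cvg_cst.
  by rewrite (cvg_shiftn N (V ^~ x)); exact: VF.
- by apply: integrableZl => //; exact: integrable_expRN.
- apply: aeW => x n /=; rewrite in_itv/= andbT => x0.
  rewrite /h lee_fin ger0_norm; last by rewrite laplace_integrand_ge0// in_itv/= x0.
  rewrite mulrC (_ : - (t / 2 * x) = t / 2 * x + - (t * x)); last by field.
  by rewrite expRD mulrA ler_wpM2r ?expR_ge0// NC//= leq_addl.
split => //.
by rewrite -(cvg_shiftn N); exact: cF.
Qed.

(** Supplies the domination when only the transforms are under control: by [laplace_tail_bound], a
    bound C on the transforms at [d] gives the growth bound d C exp(d x). *)
Lemma subexponential_laplace (V : nat -> R -> R) :
  (forall n, nondecreasing_nonneg (V n)) ->
  (forall t, 0 < t -> exists C, \forall n \near \oo, (laplace (V n) t <= C%:E)%E) ->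
  subexponential V.
Proof.
move=> HV VC d d0; have [C [N _ NC]] := VC _ d0.
exists (d * C); exists N => // n Nn x x0.
have := le_trans (laplace_tail_bound (HV n) d0 x0)
  (lee_wpmul2l (ltW d0 : (0 <= d%:E)%E) (NC _ Nn)).
by rewrite -EFinM lee_fin expRN ler_pdivrMr ?expR_gt0.
Qed.

End LaplaceTransform.

(** * Polynomial approximation and Karamata's argument *)

Section AbsPoly.
Context {R : realType}.
Implicit Types (x y a b u : R).

(** Bernoulli's inequality in reciprocal form. It yields k y (1 - y)^k <= 1, a rate 1/k that is
    uniform in y. *)
Lemma bernoulli_decay (y : R) (k : nat) : 0 <= y <= 1 ->
  (1 - y) ^+ k * (1 + k%:R * y) <= 1.
Proof.
move=> /andP[y0 y1]; elim: k => [|k IH]; first by rewrite expr0 mul0r addr0 mulr1.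
apply: (le_trans _ IH); rewrite exprSr -mulrA ler_wpM2l ?exprn_ge0 ?subr_ge0//.
rewrite -natr1 -subr_ge0 (_ : _ - _ = (k%:R + 1) * y ^+ 2); last by ring.
by rewrite mulr_ge0 ?exprn_ge0// addr_ge0.
Qed.

(* Newton-type iteration for the square root of x ^ 2. *)
Fixpoint abs_poly (k : nat) : {poly R} :=
  if k is k'.+1 then abs_poly k' + 2^-1 *: ('X ^+ 2 - abs_poly k' ^+ 2) else 0.

(** With t = |x|, the iteration satisfies t - p_(k+1) = (t - p_k) (1 - (t + p_k) / 2), and p_k >= 0
    bounds the last factor by 1 - t/2. *)
Lemma abs_polyP x (k : nat) : `|x| <= 1 ->
  0 <= (abs_poly k).[x] <= `|x| /\
  `|x| - (abs_poly k).[x] <= `|x| * (1 - `|x| / 2) ^+ k.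
Proof.
move=> x1; elim: k => [|k [/andP[p0 p1] pk]].
  by rewrite /= horner0 lexx normr_ge0 subr0 expr0 mulr1.
rewrite /= hornerD hornerZ hornerD hornerN !horner_exp hornerX.
move: p0 p1 pk; move: (abs_poly k).[x] => p p0 p1 pk.
rewrite -[x ^+ 2]real_normK ?num_real//.
have := normr_ge0 x; move: x1 p1 pk; move: `|x| => t t1 pt pk t0.
have E : t - (p + 2^-1 * (t ^+ 2 - p ^+ 2)) = (t - p) * (1 - (t + p) / 2) by field.
have d0 : 0 <= 1 - (t + p) / 2 by lra.
split; first apply/andP; first split.
- by rewrite addr_ge0// mulr_ge0// subr_ge0 lerXn2r.
- by rewrite -subr_ge0 E mulr_ge0// subr_ge0.
rewrite E exprSr mulrA; apply: ler_pM => //; rewrite ?subr_ge0//; lra.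
Qed.

Lemma abs_poly_approx (e : R) : 0 < e ->
  (* With y = |x| / 2 the error is at most 2 y (1 - y)^k <= 2 / k, so k >= 2 / e is enough. *)
  exists Q : {poly R}, forall x, `|x| <= 1 -> `| `|x| - Q.[x] | <= e.
Proof.
move=> e0; pose k := (Num.trunc (2 / e)).+1; exists (abs_poly k) => x x1.
have [/andP[p0 p1] pk] := abs_polyP k x1.
rewrite ger0_norm ?subr_ge0//; apply: (le_trans pk).
have ke : 2 / e <= k%:R by apply/ltW; exact: truncnS_gt.
have k0 : 0 < k%:R :> R by rewrite ltr0n.
have y01 : 0 <= `|x| / 2 <= 1 by have xt0 := normr_ge0 x; apply/andP; split; lra.
have := @bernoulli_decay (`|x| / 2) k y01.
have := normr_ge0 x; have P0 : 0 <= (1 - `|x| / 2) ^+ k.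
  by rewrite exprn_ge0//; have [? ?] := andP y01; lra.
move: P0; move: ((1 - `|x| / 2) ^+ k) => P P0; move: `|x| => t {}t0 H.
rewrite -(ler_pM2l k0).
have : 2 <= k%:R * e by rewrite -ler_pdivrMr.
apply: le_trans.
move: k%:R k0 H => K K0; rewrite mulrDr mulr1 => H.
have -> : K * (t * P) = 2 * (P * (K * (t / 2))) by field.
by rewrite ger_pMr// (le_trans _ H)// lerDr.
Qed.

(* the tent over [a, b], with peak (b - a) / 2 at the midpoint *)
Definition tent a b u := (`|u - a| + `|u - b| - 2 * `|u - (a + b) / 2|) / 2.

Lemma tent_ge0 a b u : 0 <= tent a b u.
Proof.
rewrite /tent divr_ge0// subr_ge0.
rewrite -[X in X * `| _ |](ger0_norm (ler0n _ 2)) -normrM.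
by rewrite (_ : 2 * _ = (u - a) + (u - b)) ?ler_normD//; field.
Qed.

Lemma tent_eq0 a b u : a <= b -> ~~ (a < u < b) -> tent a b u = 0.
Proof.
move=> ab; rewrite negb_and -!leNgt /tent => /orP[ua|bu].
  by rewrite !ler0_norm; lra.
by rewrite !ger0_norm; lra.
Qed.

Lemma tent_mid a b : a <= b -> tent a b ((a + b) / 2) = (b - a) / 2.
Proof.
move=> ab; rewrite /tent subrr normr0 mulr0 subr0.
by rewrite [X in X + _]ger0_norm ?[X in _ + X]ler0_norm; lra.
Qed.

Lemma tent_le a b u : a <= b -> tent a b u <= (b - a) / 2.
Proof.
move=> ab; case: (boolP (a < u < b)) => [/andP[au ub]|H]; last by rewrite tent_eq0//; lra.
rewrite /tent [`|u - a|]ger0_norm ?[`|u - b|]ler0_norm; [|lra..].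
have := normr_ge0 (u - (a + b) / 2); lra.
Qed.

Lemma continuous_tent a b : continuous (tent a b).
Proof.
have c z : continuous (fun u : R => `|u - z|).
  move=> u; apply: (@cvg_norm _ R); apply: (@cvgB _ R); [exact: cvg_id|exact: cvg_cst].
move=> u; rewrite /tent; apply: (@cvgM R R); last exact: cvg_cst.
apply: (@cvgB _ R); first by apply: (@cvgD _ R); exact: c.
by apply: (@cvgM R R); [exact: cvg_cst|exact: c].
Qed.

Lemma tent_poly_approx a b (e : R) : 0 <= a -> a <= b -> b <= 1 -> 0 < e ->
  exists P : {poly R}, forall u, 0 <= u <= 1 -> `|tent a b u - P.[u]| <= e.
Proof.
(* The three absolute values enter with weights 1, 1 and 2, all halved, so errors of e/2 add up to
   e. *)
move=> a0 ab b1 e0; have e2 : 0 < e / 2 by rewrite divr_gt0.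
have [Q QP] := abs_poly_approx e2.
pose S z := Q \Po ('X - z%:P).
exists (2^-1 *: (S a + S b - 2 *: S ((a + b) / 2))) => u /andP[u0 u1].
rewrite hornerZ !(hornerD, hornerN, hornerZ) /S !horner_comp !(hornerD, hornerN, hornerX, hornerC).
have B z : 0 <= z <= 1 -> `| `|u - z| - Q.[u - z] | <= e / 2.
  by move=> /andP[z0 z1]; apply: QP; rewrite ler_norml; apply/andP; split; lra.
have Ba : 0 <= a <= 1 by apply/andP; split; lra.
have Bb : 0 <= b <= 1 by apply/andP; split; lra.
have Bm : 0 <= (a + b) / 2 <= 1 by apply/andP; split; lra.
have := B _ Ba; have := B _ Bb; have := B _ Bm; rewrite /tent.
move: `|u - a| `|u - b| `|u - (a + b) / 2| Q.[u - a] Q.[u - b] Q.[u - (a + b) / 2].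
move=> p q r p' q' r'; rewrite !ler_norml => /andP[? ?] /andP[? ?] /andP[? ?].
by apply/andP; split; lra.
Qed.

End AbsPoly.

(** * Karamata's moment argument *)

Section Karamata.
Context {R : realType}.
Local Notation mu := (@lebesgue_measure R).
Local Notation I := (`[0%R, +oo[%classic : set R).
Implicit Types (f g h : R -> R) (x y z : R).

Lemma integrable_bounded_laplace f h M : nondecreasing_nonneg f ->
  laplace_finite f -> measurable_fun setT h ->
  (forall u, 0 <= u <= 1 -> `|h u| <= M) ->
  mu.-integrable I (EFin \o (fun x => h (expR (- x)) * (expR (- x) * f x))).
Proof.
move=> Hf ff mh hM.
have iL := laplace_finite_integrable Hf ff ltr01.
pose g x := (M%:E * (expR (- (1 * x)) * f x)%:E)%E.
apply: (@le_integrable _ _ _ mu I _ _ g) => //=.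
- apply/measurable_EFinP; apply: measurable_funM.
    by apply: measurable_funTS; apply: measurableT_comp => //; apply: measurableT_comp.
  apply: measurable_funM; last exact: nondecreasing_nonneg_measurable.
  by apply: measurable_funTS; apply: measurableT_comp.
- move=> x; rewrite in_itv/= andbT => x0; rewrite /= lee_fin mul1r !normrM.
  have f0 := nondecreasing_nonneg_ge0 Hf x0.
  rewrite ler_wpM2r//; apply: (le_trans _ (ler_norm _)); apply: hM.
  by rewrite expR_ge0 -expR0 ler_expR oppr_le0.
- exact: integrableZl.
Qed.

Lemma horner_bounded (P : {poly R}) :
  exists M, forall u, 0 <= u <= 1 -> `|P.[u]| <= M.
Proof.
exists (\sum_(i < size P) `|P`_i|) => u /andP[u0 u1]; rewrite horner_coef.
apply: (le_trans (ler_norm_sum _ _ _)); apply: ler_sum => i _.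
by rewrite normrM ler_piMr// normrX ger0_norm// exprn_ile1.
Qed.

(** In the variable u = exp(-x), the integral of [h] against the image on ]0, 1] of the measure
    exp(-x) V(x) dx. On the monomial u^k it is the transform of [V] at k + 1. *)
Definition moment (V : R -> R) h : R :=
  \int[mu]_(x in I) (h (expR (- x)) * (expR (- x) * V x)).

Lemma measurable_horner (P : {poly R}) : measurable_fun setT (horner P).
Proof. by apply: continuous_measurable_fun; exact: continuous_horner. Qed.

Lemma moment_poly_cvg (V : nat -> R -> R) (P : {poly R}) :
  (forall n, nondecreasing_nonneg (V n)) -> (forall n, laplace_finite (V n)) ->
  (forall k : nat, exists c : R, laplace (V n) k.+1%:R @[n --> \oo] --> c%:E) ->
  cvgn (fun n => moment (V n) (horner P)).
Proof.
move=> HV fV cV.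
have int n (Q : {poly R}) : mu.-integrable I
    (EFin \o (fun x => Q.[expR (- x)] * (expR (- x) * V n x))).
  have [M QM] := horner_bounded Q.
  by apply: (integrable_bounded_laplace (HV n) (fV n) (measurable_horner Q) QM).
(* The extra factor X^k makes the induction close: (P X + c) X^k = P X^(k+1) + c X^k, and the last
   term is a single value of the transform. *)
suff : forall k, cvgn (fun n => moment (V n) (horner (P * 'X^k))).
  by move=> /(_ 0%N); rewrite expr0 mulr1.
elim/poly_ind: P => [|P c IH] k.
  rewrite (_ : (fun n => _) = (fun=> 0)); first exact: is_cvg_cst.
  apply/funext => n; rewrite /moment mul0r.
  under eq_Rintegral do rewrite horner0 mul0r.
  by rewrite Rintegral_cst//= mul0r.
rewrite (_ : (fun n => _) = (fun n => moment (V n) (horner (P * 'X^(k.+1))) +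
    c * fine (laplace (V n) k.+1%:R))); last first.
  apply/funext => n; rewrite mulrDl -mulrA -exprS /moment.
  under eq_Rintegral do rewrite hornerD mulrDl.
  rewrite RintegralD//.
  congr (_ + _).
  rewrite (@eq_Rintegral _ _ _ mu I (fun x => c * (expR (- (k.+1%:R * x)) * V n x))).
    rewrite RintegralZl//; exact: laplace_finite_integrable.
  by move=> x _; rewrite hornerCM hornerXn -mulrN expRM_natl exprS; ring.
apply: is_cvgD; first exact: IH.
apply: is_cvgM; first exact: is_cvg_cst.
by have [d cd] := cV k; apply/cvg_ex; exists d; exact: fine_cvg.
Qed.

Lemma integral_itv_gt0 f (x0 : R) : measurable_fun setT f ->
  (forall x, 0 <= f x) -> 0 <= x0 -> {for x0, continuous f} -> 0 < f x0 ->
  (0 < \int[mu]_(x in I) (f x)%:E)%E.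
Proof.
move=> mf f0 x00 cf fx0.
have e0 : 0 < f x0 / 2 by rewrite divr_gt0.
have /cvgrPdist_lt/(_ _ e0)[d/= d0 dP] := cf.
have d20 : 0 < d / 2 by rewrite divr_gt0.
pose J := `[x0, x0 + d / 2]%classic : set R.
have mJ : measurable J by exact: measurable_itv.
apply: (@lt_le_trans _ _ (\int[mu]_(x in J) (f x0 / 2)%:E)%E).
  have muJ : mu J = (d / 2)%:E.
    rewrite /J lebesgue_measure_itv/= lte_fin ltrDl d20 -EFinB.
    by rewrite addrAC subrr add0r.
  rewrite integral_cst; last exact: measurable_itv.
  by rewrite [X in (_ * X)%E]muJ -EFinM lte_fin mulr_gt0.
apply: (@le_trans _ _ (\int[mu]_(x in J) (f x)%:E)%E).
  apply: ge0_le_integral => //=.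
  - by move=> x _; rewrite lee_fin ltW.
  - by apply/measurable_EFinP; exact: measurable_funTS.
  move=> x; rewrite /J/= in_itv/= => /andP[x0x xd]; rewrite lee_fin.
  have : `|x0 - x| < d by rewrite ler0_norm ?subr_le0//; lra.
  by move=> /dP; rewrite ltr_norml => /andP[_]; lra.
apply: ge0_subset_integral => //=.
- by apply/measurable_EFinP; exact: measurable_funTS.
- by move=> x _; rewrite lee_fin.
- by move=> x /=; rewrite !in_itv/= andbT => /andP[+ _]; exact: (le_trans x00).
Qed.

(** The tent sees only x in ]y, z[, so its moment lies between c V_n(y) and c V_n(z), where c is the
    moment of the constant 1. The moments of a nearby polynomial are Cauchy, which compares these
    bounds for two unrelated indices. *)
Lemma karamata_cauchy (V : nat -> R -> R) y z e :
  (forall n, nondecreasing_nonneg (V n)) -> (forall n, laplace_finite (V n)) ->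
  (forall k : nat, exists c : R, laplace (V n) k.+1%:R @[n --> \oo] --> c%:E) ->
  0 <= y -> y < z -> 0 < e ->
  exists N, forall n m, (N <= n)%N -> (N <= m)%N -> V n y <= V m z + e.
Proof.
move=> HV fV cV y0 yz e0.
pose a := expR (- z); pose b := expR (- y).
have ab : a < b by rewrite ltr_expR ltrN2.
have a0 : 0 < a := expR_gt0 _.
have b1 : b <= 1 by rewrite /b -expR0 ler_expR oppr_le0.
have tM u : 0 <= u <= 1 -> `|tent a b u| <= (b - a) / 2.
  by move=> _; rewrite ger0_norm ?tent_ge0// tent_le// ltW.
have mt : measurable_fun setT (tent a b).
  by apply: continuous_measurable_fun; exact: continuous_tent.
have it n : mu.-integrable I
    (EFin \o (fun x => tent a b (expR (- x)) * (expR (- x) * V n x))).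
  exact: integrable_bounded_laplace mt tM.
have nn1 : nondecreasing_nonneg (fun=> 1 : R) by split.
have f1 : laplace_finite (fun=> 1 : R).
  move=> t t0; have /integrableP[_] := integrable_expRN t0.
  congr (_ < _)%E; apply: eq_integral => x _.
  by rewrite mulr1 gee0_abs// lee_fin expR_ge0.
have itc : mu.-integrable I (EFin \o (fun x => tent a b (expR (- x)) * (expR (- x) * 1))).
  exact: integrable_bounded_laplace nn1 f1 mt tM.
pose c := moment (fun=> 1) (tent a b).
have c0 : 0 < c.
  pose m := (a + b) / 2.
  have m0 : 0 < m by rewrite divr_gt0 ?addr_gt0 ?expR_gt0.
  rewrite /c /moment -lte_fin fineK; last by apply: integrable_fin_num => //; exact: itc.
  (* At this point exp(-x) is the midpoint of [a, b], where the tent has its peak. *)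
  apply: (@integral_itv_gt0 _ (- ln m)).
  - apply: measurable_funM.
      by apply: measurableT_comp => //; apply: measurableT_comp.
    by apply: measurable_funM => //; apply: measurableT_comp.
  - by move=> x; rewrite mulr_ge0 ?tent_ge0// mulr1 expR_ge0.
  - rewrite oppr_ge0 ln_le0// /m; lra.
  - have cN : continuous (fun x : R => expR (- x)).
      rewrite (_ : (fun x => _) = (fun x : R => expR (- (1 * x)))).
        exact: continuous_expRN.
      by apply/funext => x; rewrite mul1r.
    apply: (@cvgM R R); first by
      apply: (@continuous_comp _ _ _ (fun x : R => expR (- x)) (tent a b));
      [exact: cN|exact: continuous_tent].
    by apply: (@cvgM R R); [exact: cN|exact: cvg_cst].
  - by rewrite opprK lnK// tent_mid ?ltW// mulr1 mulr_gt0// divr_gt0// subr_gt0.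
have supp x : 0 < tent a b (expR (- x)) -> y < x < z.
  move=> t0; have : a < expR (- x) < b.
    by apply: contraLR t0 => /(tent_eq0 (ltW ab)) ->; rewrite ltxx.
  by rewrite /a /b !ltr_expR !ltrN2 andbC.
have zp : 0 <= z by rewrite (le_trans y0)// ltW.
have fx n x : 0 <= x -> y < x < z -> V n y <= V n x <= V n z.
  by move=> x0 /andP[yx xz]; rewrite !(nondecreasing_nonneg_le (HV n))// ltW.
have bounds n : c * V n y <= moment (V n) (tent a b) <= c * V n z.
  have cE w : c * w = \int[mu]_(x in I) (tent a b (expR (- x)) * (expR (- x) * 1) * w).
    by rewrite /c /moment RintegralZr.
  have iw w : mu.-integrable I
      (EFin \o (fun x => tent a b (expR (- x)) * (expR (- x) * 1) * w)).
    by under [X in _.-integrable _ X]eq_fun do rewrite /= EFinM; exact: integrableZr.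
  have tx x : 0 <= x -> tent a b (expR (- x)) = 0 \/ y < x < z.
    move=> x0; have := tent_ge0 a b (expR (- x)).
    by rewrite le_eqVlt => /orP[/eqP<-|/supp]; [left|right].
  rewrite !cE; apply/andP; split; apply: le_Rintegral => // x;
    rewrite /= in_itv/= andbT => x0; case: (tx _ x0) => [->|xyz]; rewrite ?mul0r//;
    rewrite mulr1 -mulrA; apply: ler_wpM2l; rewrite ?tent_ge0//;
    apply: ler_wpM2l; rewrite ?expR_ge0//; by have /andP[] := fx n x x0 xyz.
have [c1 c1P] := cV 0%N.
pose L n := fine (laplace (V n) 1).
have cL : L n @[n --> \oo] --> c1 by exact: fine_cvg.
have L0 n : 0 <= L n by rewrite fine_ge0// laplace_ge0.
have c1_ge0 : 0 <= c1.
  rewrite -(cvg_lim _ cL)//.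
  by apply: limr_ge; [apply/cvg_ex; exists c1|exact: nearW].
(* The polynomial error is multiplied by the mass [L n], which is eventually at most c1 + 1, and so
   becomes c e / 4. Two such errors and two distances to the limit of the polynomial moments add up
   to c e. *)
have ce0 : 0 < c * e / (4 * (c1 + 1)) by rewrite divr_gt0 ?mulr_gt0// ltr_wpDl.
have [P PP] := tent_poly_approx (ltW a0) (ltW ab) b1 ce0.
have cP := moment_poly_cvg (P := P) HV fV cV.
have approx n : `|moment (V n) (tent a b) - moment (V n) (horner P)| <=
    c * e / (4 * (c1 + 1)) * L n.
  have [M PM] := horner_bounded P.
  have iP := integrable_bounded_laplace (HV n) (fV n) (measurable_horner P) PM.
  have iL := laplace_finite_integrable (HV n) (fV n) ltr01.
  pose D x := tent a b (expR (- x)) * (expR (- x) * V n x) -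
    P.[expR (- x)] * (expR (- x) * V n x).
  have iD : mu.-integrable I (EFin \o D).
    exact: (integrableB _ (it n) iP).
  rewrite /moment -RintegralB// (le_trans (le_normr_Rintegral _ iD))//.
  rewrite /L /laplace -RintegralZl//; apply: le_Rintegral => //.
  - exact: (integrable_norm iD).
  - by apply: (integrableZl _ _ iL).
  move=> x; rewrite /= in_itv/= andbT => x0.
  rewrite /D -mulrBl normrM mul1r [X in _ * X <= _]ger0_norm; last first.
    by rewrite mulr_ge0 ?expR_ge0// nondecreasing_nonneg_ge0.
  rewrite ler_wpM2r ?mulr_ge0 ?expR_ge0 ?nondecreasing_nonneg_ge0//.
  by apply: PP; rewrite expR_ge0 -expR0 ler_expR oppr_le0.
have e40 : 0 < c * e / 4 by rewrite divr_gt0// mulr_gt0.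
have /cvgrPdist_lt/(_ _ e40)[N1 _ N1P] := cP.
have [N2 _ N2P] : \forall n \near \oo, L n <= c1 + 1.
  by apply: (cvgr_le _ cL); rewrite ltrDl.
exists (maxn N1 N2) => n m; rewrite !geq_max => /andP[n1 n2] /andP[m1 m2].
rewrite -(ler_pM2l c0) mulrDr.
have /andP[+ _] := bounds n; have /andP[_] := bounds m.
have apx k : (N2 <= k)%N -> c * e / (4 * (c1 + 1)) * L k <= c * e / 4.
  move=> /N2P /= Lk; rewrite invfM mulrA -mulrA ler_piMr ?(ltW e40)//.
  by rewrite ler_pdivrMl ?mulr1// ltr_wpDl.
have := le_trans (approx n) (apx n n2); have := le_trans (approx m) (apx m m2).
have := N1P _ n1; have := N1P _ m1.
rewrite /= !ltr_norml !ler_norml => /andP[? ?] /andP[? ?] /andP[? ?] /andP[? ?] ? ?.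
lra.
Qed.

End Karamata.

(** * Complete monotonicity *)

Section CompleteMonotonicity.
Context {R : realType}.
Implicit Types (f h : R -> R) (s t x y : R).
Local Notation I := (`[0%R, +oo[%classic : set R).

Lemma exprn_le_expR (k : nat) (d : R) : 0 < d ->
  exists2 C, 0 < C & forall y, 0 <= y -> y ^+ k <= C * expR (d * y).
Proof.
move=> d0; case: k => [|k].
  exists 1 => // y y0; rewrite expr0 mul1r.
  by rewrite -expR0 ler_expR mulr_ge0// ltW.
have F0 : 0 < (k.+1)`!%:R / d ^+ k.+1 by rewrite divr_gt0 ?ltr0n ?fact_gt0 ?exprn_gt0.
exists ((k.+1)`!%:R / d ^+ k.+1) => // y y0.
have dy : 0 <= d * y by rewrite mulr_ge0// ltW.
rewrite -ler_pdivrMl// invf_div.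
apply: (le_trans _ (expR_ge1Dxn k dy)).
by rewrite exprMn mulrAC lerDr.
Qed.

Section derivatives.
Variable f : R -> R.
Hypotheses (Hf : nondecreasing_nonneg f) (ff : laplace_finite f).
Local Notation m := (lebesgue_stieltjes_measure (rc_ext f)).

Lemma integrable_expRN_stieltjes t : 0 < t ->
  m.-integrable I (fun y => (expR (- (t * y)))%:E).
Proof.
move=> t0; apply/integrableP; split.
  by apply/measurable_EFinP; exact: measurable_expRN.
rewrite [ltLHS](_ : _ = laplace_stieltjes f t).
  by rewrite laplace_stieltjesE// lte_mul_pinfty ?lee_fin ?ltW// ff.
by apply: eq_integral => y _; rewrite gee0_abs// lee_fin expR_ge0.
Qed.

(** The absolute value makes the function nonnegative on the whole line, so that it can serve as
    majorant when differentiating under the integral. *)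
Lemma integrable_pow_expRN_stieltjes (k : nat) t : 0 < t ->
  m.-integrable I (fun y => (`|y| ^+ k * expR (- (t * y)))%:E).
Proof.
move=> t0; have t20 : 0 < t / 2 by rewrite divr_gt0.
have [C C0 CP] := exprn_le_expR k t20.
have mI : measurable I by [].
pose g y := (C%:E * (expR (- (t / 2 * y)))%:E)%E.
have ig : m.-integrable I g by apply: integrableZl => //; exact: integrable_expRN_stieltjes.
apply: (@le_integrable _ _ _ m I mI _ g) => //=.
- apply/measurable_EFinP; apply: measurable_funM.
    by apply: measurable_funTS; apply: measurable_funX; exact: normr_measurable.
  exact: measurable_expRN.
move=> y; rewrite in_itv/= andbT => y0; rewrite /= lee_fin ger0_norm; last first.
  by rewrite mulr_ge0 ?expR_ge0// exprn_ge0.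
rewrite (ger0_norm y0); apply: (le_trans _ (ler_norm _)).
rewrite (_ : - (t / 2 * y) = t / 2 * y + - (t * y)); last by field.
by rewrite expRD mulrA ler_wpM2r ?expR_ge0// CP.
Qed.

Definition stieltjes_moment (k : nat) s : R :=
  \int[m]_(y in I) ((- y) ^+ k * expR (- (s * y))).

Lemma integrable_stieltjes_moment (k : nat) s : 0 < s ->
  m.-integrable I (EFin \o (fun y => (- y) ^+ k * expR (- (s * y)))).
Proof.
move=> s0; have mI : measurable I by [].
apply: (@le_integrable _ _ _ m I mI _ _ _ _ (integrable_pow_expRN_stieltjes k s0)) => //=.
- apply/measurable_EFinP; apply: measurable_funM; last exact: measurable_expRN.
  by apply: measurable_funTS; apply: measurable_funX; exact: oppr_measurable.
by move=> y _; rewrite /= lee_fin !normrM !normrX normrN normr_id.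
Qed.

Lemma is_derive_stieltjes_moment (k : nat) s : 0 < s ->
  is_derive s 1 (stieltjes_moment k) (stieltjes_moment k.+1 s).
Proof.
move=> s0; have s20 : 0 < s / 2 by rewrite divr_gt0.
pose g (x y : R) := (- y) ^+ k * expR (- (x * y)).
(* A neighbourhood of [s] bounded away from 0: on it exp(-x y) <= exp(-(s / 2) y) for all y >= 0. *)
have Ig : (`](s / 2), (2 * s)[%classic : set R) s.
  by rewrite /= in_itv/=; apply/andP; split; lra.
have Ipos x : (`](s / 2), (2 * s)[%classic : set R) x -> s / 2 < x.
  by rewrite /= in_itv/= => /andP[].
have dg x y : is_derive x 1 (g ^~ y) ((- y) ^+ k.+1 * expR (- (x * y))).
  have H : is_derive x (1:R) (fun x : R => expR (- (x * y))) (- (y * expR (- (y * x)))).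
    have := is_derive_expRN y x.
    by rewrite (_ : (fun x : R => expR (- (x * y))) = (fun x : R => expR (- (y * x))))//;
      apply/funext => z; rewrite mulrC.
  apply: is_derive_eq; rewrite /GRing.scale/= exprS (mulrC x y); ring.
have d1g x y : partial1of2 g x y = (- y) ^+ k.+1 * expR (- (x * y)).
  by rewrite partial1of2E; case: (dg x y).
have intg x : (`](s / 2), (2 * s)[%classic : set R) x -> m.-integrable I (EFin \o g x).
  by move=> /Ipos sx; apply: integrable_stieltjes_moment; exact: lt_trans sx.
have derg x y : (`](s / 2), (2 * s)[%classic : set R) x -> I y -> derivable (g ^~ y) x 1.
  by move=> _ _; case: (dg x y).
pose G y := `|y| ^+ k.+1 * expR (- (s / 2 * y)).
have G0 y : 0 <= G y by rewrite mulr_ge0 ?expR_ge0// exprn_ge0.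
have iG : m.-integrable I (EFin \o G) by exact: integrable_pow_expRN_stieltjes.
have gG x y : (`](s / 2), (2 * s)[%classic : set R) x -> I y -> `|partial1of2 g x y| <= G y.
  move=> /Ipos sx; rewrite /= in_itv/= andbT => y0; rewrite d1g normrM normrX normrN.
  rewrite [X in _ * X <= _]ger0_norm ?expR_ge0// ler_wpM2l ?exprn_ge0//.
  by rewrite ler_expR lerN2 ler_wpM2r// ltW.
apply: DeriveDef.
  exact: (@derivable_under_integral _ _ _ m g I _ s _ _ Ig intg derg G G0 iG gG).
have := @differentiation_under_integral _ _ _ m g I _ s _ _ Ig intg derg G G0 iG gG.
rewrite derive1E => ->; last exact: measurable_itv.
by apply: eq_Rintegral => y _; rewrite d1g.
Qed.

(** [h] is controlled only on the open half-line. Each derivative is identified there, and the next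
    one follows because differentiation is local. *)
Lemma derive1n_stieltjes_moment h :
  (forall s, 0 < s -> (h s)%:E = laplace_stieltjes f s) ->
  forall (n : nat) s, 0 < s ->
    derivable (derive1n n h) s 1 /\ derive1n n h s = stieltjes_moment n s.
Proof.
move=> hE.
suff H (n : nat) : (forall s, 0 < s -> derive1n n h s = stieltjes_moment n s) ->
    forall s, 0 < s -> is_derive s 1 (derive1n n h) (stieltjes_moment n.+1 s).
  have E (n : nat) : forall s, 0 < s -> derive1n n h s = stieltjes_moment n s.
    elim: n => [|n IH] s s0.
      rewrite /= /stieltjes_moment /Rintegral -[LHS]/(fine (h s)%:E) hE//.
      by congr fine; apply: eq_integral => y _; rewrite expr0 mul1r.
    by rewrite derive1nS derive1E; case: (H n IH s s0).
  by move=> n s s0; split; [case: (H n (E n) s s0)|exact: E].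
move=> nE s s0.
apply: near_eq_is_derive (is_derive_stieltjes_moment n s0).
by near=> z; rewrite nE//; near: z; exact: lt_nbhsr.
Unshelve. all: by end_near. Qed.

Lemma completely_monotone_laplace h :
  (forall s, 0 < s -> (h s)%:E = laplace_stieltjes f s) ->
  completely_monotone h.
Proof.
move=> hE n s s0; have [dh hn] := derive1n_stieltjes_moment hE n s0.
split=> //; rewrite hn /stieltjes_moment -RintegralZl//; last first.
  exact: integrable_stieltjes_moment.
apply: Rintegral_ge0 => y; rewrite /= in_itv/= andbT => y0.
by rewrite mulrA -exprMn mulN1r opprK mulr_ge0 ?expR_ge0// exprn_ge0.
Qed.

End derivatives.
End CompleteMonotonicity.

(** * Uniform convergence and geometric scales *)

Section Misc.
Context {R : realType}.
Implicit Types (f g h : R -> R) (x y z e : R).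

Lemma laplace_eq_pos f g t : nondecreasing_nonneg f -> nondecreasing_nonneg g ->
  (forall x, 0 < x -> f x = g x) -> laplace f t = laplace g t.
Proof.
move=> Hf Hg fg; rewrite /laplace.
have sub : (`]0%R, +oo[%classic : set R) `<=` `[0%R, +oo[%classic.
  by move=> x /=; rewrite !in_itv/= !andbT; exact: ltW.
have m k : nondecreasing_nonneg k -> measurable_fun (`]0%R, +oo[ : set R)
    (fun x => (expR (- (t * x)) * k x)%:E).
  by move=> Hk; apply: measurable_funS (measurable_laplace t Hk).
rewrite -!integral_itv_obnd_cbnd; [|exact: m..].
by apply: eq_integral => x; rewrite inE/= in_itv/= andbT => x0; rewrite fg.
Qed.

(** Near [x], the values of [g n] at x - d and x + d trap [g n] on the whole ball by monotonicity,
    and compactness of [a, b] makes the index uniform. Taking d < x keeps x - d in the half-line of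
    the hypotheses. *)
Lemma uniform_cvg_monotone (g : nat -> R -> R) f a b e : 0 < a ->
  (forall n x y, 0 < x -> x <= y -> g n x <= g n y) ->
  (forall x, 0 < x -> g n x @[n --> \oo] --> f x) ->
  (forall x, 0 < x -> {for x, continuous f}) -> 0 < e ->
  \forall n \near \oo, forall x, a <= x <= b -> `|g n x - f x| < e.
Proof.
move=> a0 gm gf cf e0.
have e4 : 0 < e / 4 by rewrite divr_gt0.
have cov := (compact_near_coveringP _).1 (@segment_compact R a b).
suff /(cov nat \oo (fun n x => `|g n x - f x| < e)) : forall x,
    `[a, b]%classic x -> \forall x' \near x & n \near \oo, `|g n x' - f x'| < e.
  by apply: filterS => n nP x xab; apply: nP; rewrite /= in_itv.
move=> x; rewrite /= in_itv/= => /andP[ax _].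
have x0 : 0 < x := lt_le_trans a0 ax.
have /cvgrPdist_lt/(_ _ e4)[d1/= d10 d1P] := cf _ x0.
pose d := Num.min d1 x / 2.
have d0 : 0 < d by rewrite divr_gt0// lt_min d10.
have dd1 : d < d1.
  by rewrite ltr_pdivrMr// (@le_lt_trans _ _ d1)// ?ge_min ?lexx// ltr_pMr// ltr1n.
have dx : d < x.
  by rewrite ltr_pdivrMr// (@le_lt_trans _ _ x)// ?ge_min ?lexx ?orbT// ltr_pMr// ltr1n.
have xd0 : 0 < x - d by rewrite subr_gt0.
have xd0' : 0 < x + d by rewrite addr_gt0.
have /cvgrPdist_lt/(_ _ e4) Nm := gf _ xd0.
have /cvgrPdist_lt/(_ _ e4) Np := gf _ xd0'.
exists (ball x d, [set n | `|f (x - d) - g n (x - d)| < e / 4 /\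
                          `|f (x + d) - g n (x + d)| < e / 4]).
  split; first exact: nbhsx_ballx.
  by near=> n; split; near: n.
move=> [z n] /= [xz [gm1 gp1]].
move: xz; rewrite /ball/= => xz; have /andP[xz1 xz2] : x - d <= z <= x + d.
  by move: xz; rewrite ltr_norml => /andP[? ?]; apply/andP; split; lra.
have z0 : 0 < z := lt_le_trans xd0 xz1.
have g1 := gm n _ _ xd0 xz1; have g2 := gm n _ _ z0 xz2.
have fm : `|f x - f (x - d)| < e / 4 by apply: d1P; rewrite /= opprB addrC subrK gtr0_norm.
have fp : `|f x - f (x + d)| < e / 4 by apply: d1P; rewrite /= opprD addNKr normrN gtr0_norm.
have fz : `|f x - f z| < e / 4 by apply: d1P => /=; exact: lt_trans dd1.
move: fm fp fz gm1 gp1; rewrite !ltr_norml.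
move=> /andP[? ?] /andP[? ?] /andP[? ?] /andP[? ?] /andP[? ?].
by apply/andP; split; lra.
Unshelve. all: by end_near. Qed.

Lemma near1_mul e : 0 < e -> exists2 d, 0 < d & forall a b : R,
  `|a - 1| < d -> `|b - 1| < d -> `|a * b - 1| < e.
Proof.
move=> e0; pose d := Num.min 1 (e / 3); exists d.
  by rewrite lt_min ltr01 divr_gt0.
have d1 : d <= 1 by rewrite ge_min lexx.
have d3 : d <= e / 3 by rewrite ge_min lexx orbT.
move=> a b a1 b1; rewrite (_ : a * b - 1 = (a - 1) * b + (b - 1)); last by ring.
apply: (le_lt_trans (ler_normD _ _)); rewrite normrM.
have b2 : `|b| <= 2.
  by rewrite -[b](subrK 1) (le_trans (ler_normD _ _))// normr1; lra.
have := ler_wpM2l (normr_ge0 (a - 1)) b2; lra.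
Qed.

Lemma near1_inv e : 0 < e -> exists2 d, 0 < d & forall a : R,
  `|a - 1| < d -> `|a^-1 - 1| < e.
Proof.
move=> e0; pose d := Num.min (1 / 2) (e / 2); exists d.
  by rewrite lt_min !divr_gt0.
have d1 : d <= 1 / 2 by rewrite ge_min lexx.
have d3 : d <= e / 2 by rewrite ge_min lexx orbT.
move=> a ad.
have a12 : 1 / 2 < a by move: ad; rewrite ltr_norml => /andP[]; lra.
have a0 : 0 < a by lra.
rewrite (_ : a^-1 - 1 = - ((a - 1) / a)); last by field; exact: lt0r_neq0.
rewrite normrN normrM normfV (gtr0_norm a0) ltr_pdivrMr//.
by apply: (lt_le_trans ad); nra.
Qed.

Lemma expn_unbounded (r M : R) : 1 < r -> exists n : nat, M < r ^+ n.
Proof.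
move=> r1; have r10 : 0 < r - 1 by rewrite subr_gt0.
pose n := (Num.trunc (M / (r - 1))).+1; exists n.
apply: (@lt_le_trans _ _ (n%:R * (r - 1))).
  by rewrite -ltr_pdivrMr//; exact: truncnS_gt.
elim: {M}n => [|n IH]; first by rewrite mul0r expr0.
rewrite exprS -natr1 mulrDl mul1r.
have : 1 <= r ^+ n by rewrite exprn_ege1// ltW.
have : r * r ^+ n = r ^+ n + (r - 1) * r ^+ n by ring.
have : (r - 1) * 1 <= (r - 1) * r ^+ n by rewrite ler_wpM2l ?exprn_ege1// ltW.
lra.
Qed.

Lemma scale_decomposition (r x : R) : 1 < r -> 1 <= x ->
  exists n u, 1 <= u <= r /\ x = r ^+ n * u.
Proof.
move=> r1 x1; have r0 : 0 < r := lt_trans ltr01 r1.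
have [n0 n0P] := expn_unbounded x r1.
have ex : exists n, x < r ^+ n by exists n0.
case: (ex_minnP ex) => -[|m]; first by rewrite expr0 ltNge x1.
move=> xm mmin; exists m, (x / r ^+ m); split; last first.
  by rewrite mulrC divfK// expf_neq0// gt_eqF.
rewrite ler_pdivlMr ?exprn_gt0// mul1r ler_pdivrMr ?exprn_gt0// -exprS (ltW xm) andbT.
rewrite leNgt; apply/negP => /mmin; by rewrite ltnn.
Qed.

Lemma cvg_geometric_uniform (r L : R) h : 1 < r ->
  (forall e, 0 < e -> \forall n \near \oo, forall u, 1 <= u <= r ->
     `|h (r ^+ n * u) - L| < e) ->
  h x @[x --> +oo] --> L.
Proof.
move=> r1 H; have r0 : 0 < r := lt_trans ltr01 r1.
apply/cvgrPdist_lt => e e0; have [N _ NP] := H _ e0.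
have rN : 1 <= r ^+ N by rewrite exprn_ege1// ltW.
near=> x.
(* If n < N, then r^n u <= r^N r for every u in [1, r]; beyond this threshold the exponent of [x] is
   at least N. *)
have xN : r ^+ N * r < x by near: x; apply: nbhs_pinfty_gt; exact: num_real.
have [n [u [/andP[u1 ur] xE]]] : exists n u, 1 <= u <= r /\ x = r ^+ n * u.
  by apply: scale_decomposition => //; nra.
rewrite distrC xE; apply: NP; last by rewrite u1.
rewrite /= leqNgt; apply/negP => nN.
have : r ^+ n * u <= r ^+ N * r.
  apply: ler_pM => //; [exact/exprn_ge0/ltW|exact: le_trans u1|].
  by rewrite ler_eXn2l// ltnW.
by rewrite -xE leNgt xN.
Unshelve. all: by end_near. Qed.

Lemma periodic_expn (r : R) (p : R -> R) n x : 0 < r ->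
  (forall x, 0 < x -> p (x * r) = p x) -> 0 < x -> p (r ^+ n * x) = p x.
Proof.
move=> r0 pr x0; elim: n => [|n IH]; first by rewrite expr0 mul1r.
by rewrite exprS mulrC mulrA mulrAC pr ?(mulrC x)// mulr_gt0// exprn_gt0.
Qed.

Lemma periodic_fundamental (r : R) (p : R -> R) x : 1 < r ->
  (forall x, 0 < x -> p (x * r) = p x) -> 0 < x ->
  exists2 u, 1 <= u <= r & p x = p u.
Proof.
move=> r1 pr x0; have r0 : 0 < r := lt_trans ltr01 r1.
have [k kP] := expn_unbounded x^-1 r1.
have kx : 1 <= r ^+ k * x by rewrite -ler_pdivrMr// mul1r ltW.
have [n [u [ur xE]]] := scale_decomposition r1 kx.
exists u => //; rewrite -(periodic_expn k r0 pr x0) xE periodic_expn//.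
by case/andP: ur => + _; exact: lt_le_trans.
Qed.

Lemma calP_of_bounds (r a b : R) (p : R -> R) : 1 < r -> 0 < a ->
  (forall u, 1 <= u <= r -> a <= p u <= b) ->
  (forall x, 0 < x -> p y @[y --> x^'+] --> p x) ->
  (forall x, 0 < x -> p (x * r) = p x) -> calP r p.
Proof.
move=> r1 a0 pab prc pr.
have pB x : 0 < x -> a <= p x <= b.
  by move=> x0; have [u ur xu] := periodic_fundamental r1 pr x0; rewrite xu; exact: pab.
split => //.
- by move=> x /pB/andP[+ _]; exact: lt_le_trans.
- by exists b => x /pB/andP[].
apply: (lt_le_trans a0); apply: lb_le_inf.
  by exists (p 1), 1 => //=; rewrite in_itv/= lexx ltW.
by move=> y [u] /=; rewrite in_itv/= => ur <-; have /andP[] := pab _ ur.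
Qed.

End Misc.

(** * Rescaling *)

Section ContinuousScale.
Context {R : realType}.
Implicit Types (p : R -> R) (a x : R).

Lemma continuous_scale p a x : 0 < a ->
  {for x, continuous (fun y => p (a * y))} -> {for a * x, continuous p}.
Proof.
move=> a0 /cvgrPdist_lt cp; apply/cvgrPdist_lt => e /cp[d/= d0 dP].
exists (a * d) => /=; first by rewrite mulr_gt0.
move=> y /= ayd; have := dP (a^-1 * y); rewrite mulVKf ?gt_eqF//; apply.
rewrite /= -(ltr_pM2l a0) -{1}(gtr0_norm a0) -normrM mulrBr mulVKf ?gt_eqF//.
Qed.

Lemma right_continuous_scale p a x : 0 < a ->
  p y @[y --> (a * x)^'+] --> p (a * x) ->
  p (a * y) @[y --> x^'+] --> p (a * x).
Proof.
move=> a0 /cvgrPdist_lt cp; apply/cvgrPdist_lt => e /cp[d/= d0 dP].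
exists (d / a) => /=; first by rewrite divr_gt0.
move=> y /= ayd xy; apply: dP; last by rewrite ltr_pM2l.
by rewrite /= -mulrBr normrM (gtr0_norm a0) mulrC -ltr_pdivlMr.
Qed.

Lemma continuous_powR (a x : R) : 0 < x -> {for x, continuous (@powR R ^~ a)}.
Proof.
move=> x0; apply: differentiable_continuous; apply/derivable1_diffP.
by apply: derivable_powR; rewrite in_itv/= x0.
Qed.

End ContinuousScale.

Section Rescaling.
Context {R : realType}.
Variables (U l : R -> R) (rho r : R).
Hypotheses (HU : nondecreasing_nonneg U) (r1 : 1 < r)
  (sl : slowly_varying l).

Definition norming n : R := (r ^+ n) `^ rho * l (r ^+ n).
(** Dividing by [l (r ^+ n)] rather than by [l (r ^+ n * x)] keeps the function nondecreasing in
    [x]; slow variation makes up for the difference in [growth_rescaled]. *)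
Definition rescaled n (x : R) : R := (norming n)^-1 * U (r ^+ n * x).

Let r0 : 0 < r := lt_trans ltr01 r1.
Let rn0 n : 0 < r ^+ n := exprn_gt0 n r0.
Let l0 x : 0 < x -> 0 < l x. Proof. by case: sl => + _ _; exact. Qed.

Lemma norming_gt0 n : 0 < norming n.
Proof. by rewrite mulr_gt0 ?powR_gt0 ?l0. Qed.

Lemma rescaled_nondecreasing n : nondecreasing_nonneg (rescaled n).
Proof.
apply: nondecreasing_nonneg_scale => //; first exact: ltW.
by rewrite invr_ge0 ltW// norming_gt0.
Qed.

Lemma laplace_rescaled n t :
  laplace (rescaled n) t = (((norming n)^-1 / r ^+ n)%:E * laplace U (t / r ^+ n))%E.
Proof. by rewrite laplace_scale// invr_ge0 ltW// norming_gt0. Qed.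

Lemma laplace_stieltjes_rescaled n t : 0 < t ->
  laplace_stieltjes U (t / r ^+ n) =
  ((norming n * t)%:E * laplace (rescaled n) t)%E.
Proof.
move=> t0; rewrite laplace_stieltjesE ?divr_gt0// laplace_rescaled muleA -EFinM.
congr (_%:E * _)%E; have := norming_gt0 n; have := rn0 n.
by move: (norming n) (r ^+ n) => a b b0 a0; field; rewrite !gt_eqF.
Qed.

Lemma laplace_finite_rescaled : laplace_finite U ->
  forall n, laplace_finite (rescaled n).
Proof.
move=> fU n t t0; rewrite laplace_rescaled lte_mul_pinfty//.
  by rewrite lee_fin mulr_ge0// invr_ge0 ltW// norming_gt0.
by apply: fU; rewrite divr_gt0.
Qed.

Lemma cvg_expn_pinfty : r ^+ n @[n --> \oo] --> +oo.
Proof.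
apply/cvgryPge => M; have [k kM] := expn_unbounded M r1.
by exists k => // n kn; rewrite (le_trans (ltW kM))// ler_weXn2l// ltW.
Qed.

Lemma cvg_div_expn_right s : 0 < s -> s / r ^+ n @[n --> \oo] --> 0^'+.
Proof.
move=> s0; have cs : s / r ^+ n @[n --> \oo] --> 0.
  rewrite -[X in _ --> X](mulr0 s); apply: cvgM; first exact: cvg_cst.
  by apply/gtr0_cvgV0; [exact: nearW|exact: cvg_expn_pinfty].
move=> P [d/= d0 dP]; have /cvgrPdist_lt/(_ _ d0)[N _ NP] := cs.
by exists N => // n Nn; apply: dP; [exact: NP|rewrite /= divr_gt0].
Qed.

Lemma slow_ratio_cvg z : 0 < z ->
  l (r ^+ n * z) / l (r ^+ n) @[n --> \oo] --> (1 : R).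
Proof.
move=> z0; have [_ _ /(_ z z0)] := sl.
move=> /(cvg_comp _ _ cvg_expn_pinfty); apply: cvg_trans.
by apply: near_eq_cvg; apply: nearW => n /=; rewrite (mulrC z).
Qed.

Lemma slow_ratio_uniform e : 0 < e ->
  \forall n \near \oo, forall u, 1 <= u <= r ->
    `|l (r ^+ n * u) / l (r ^+ n) - 1| < e.
Proof.
move=> e0; have := slowly_varying_uniform sl (ltW r1) e0.
move=> /cvg_expn_pinfty[N _ NP]; exists N => // n /NP /= nP u ur.
by rewrite (mulrC _ u); exact: nP.
Qed.

Lemma normingS_cvg : norming n.+1 / norming n @[n --> \oo] --> r `^ rho.
Proof.
rewrite -[X in _ --> X]mulr1.
rewrite (_ : (fun n => _) = (fun n => r `^ rho * (l (r ^+ n * r) / l (r ^+ n)))).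
  by apply: cvgM; [exact: cvg_cst|exact: slow_ratio_cvg].
apply/funext => n; rewrite /norming exprSr powRM ?ltW//.
have := l0 (rn0 n); have := powR_gt0 rho (rn0 n).
by move: (l (r ^+ n)) ((r ^+ n) `^ rho) => a b b0 a0; field; rewrite !gt_eqF.
Qed.

Lemma growth_rescaledE n z : 0 < z ->
  U (r ^+ n * z) / ((r ^+ n * z) `^ rho * l (r ^+ n * z)) =
  rescaled n z / z `^ rho * (l (r ^+ n * z) / l (r ^+ n))^-1.
Proof.
move=> z0; rewrite /rescaled /norming powRM ?ltW//.
have := l0 (rn0 n); have := powR_gt0 rho (rn0 n); have := powR_gt0 rho z0.
have : 0 < l (r ^+ n * z) by rewrite l0// mulr_gt0.
move: (l (r ^+ n)) (l (r ^+ n * z)) ((r ^+ n) `^ rho) (z `^ rho) => a b c d b0 d0 c0 a0.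
by field; rewrite !gt_eqF.
Qed.

Lemma growth_rescaled z c : 0 < z ->
  (U (r ^+ n * z) / ((r ^+ n * z) `^ rho * l (r ^+ n * z)) @[n --> \oo] --> c) <->
  (rescaled n z @[n --> \oo] --> z `^ rho * c).
Proof.
move=> z0; have zr := powR_gt0 rho z0; split=> H.
  rewrite (_ : rescaled ^~ z = (fun n => z `^ rho *
      (U (r ^+ n * z) / ((r ^+ n * z) `^ rho * l (r ^+ n * z))) *
      (l (r ^+ n * z) / l (r ^+ n)))).
    rewrite -[X in _ --> X]mulr1; apply: cvgM; last exact: slow_ratio_cvg.
    by apply: cvgM => //; exact: cvg_cst.
  apply/funext => n; rewrite growth_rescaledE//.
  have := l0 (rn0 n); have : 0 < l (r ^+ n * z) by rewrite l0// mulr_gt0.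
  move: (z `^ rho) zr (l (r ^+ n)) (l (r ^+ n * z)) => d d0 a b b0 a0.
  by field; rewrite !gt_eqF.
rewrite (_ : (fun n => _) = (fun n => rescaled n z / z `^ rho *
    (l (r ^+ n * z) / l (r ^+ n))^-1)); last first.
  by apply/funext => n; rewrite growth_rescaledE.
have -> : c = z `^ rho * c / z `^ rho * 1^-1 by rewrite invr1 mulr1 mulrC mulKf ?gt_eqF.
apply: cvgM; first by apply: cvgM => //; exact: cvg_cst.
by apply: cvgV; [exact: oner_neq0|exact: slow_ratio_cvg].
Qed.

End Rescaling.

(** * From the growth of U to its transform *)

Section LimitFunction.
Context {R : realType}.
Variables (rho r : R) (p : R -> R).
Hypotheses (r1 : 1 < r) (Hp : calP r p).

(** The value 0 at 0 lies below all positive values and respects the scaling by [r]. When rho = 0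
    the atom at 0 is not lost, since [rc_ext] takes the right limit there. *)
Definition limit_fun (x : R) : R := if 0 < x then x `^ rho * p x else 0.

Let r0 : 0 < r := lt_trans ltr01 r1.
Let p0 x : 0 < x -> 0 < p x. Proof. by case: Hp => + _ _ _ _; exact. Qed.
Let prc x : 0 < x -> p y @[y --> x^'+] --> p x.
Proof. by case: Hp => _ _ + _ _; exact. Qed.

Lemma limit_funE x : 0 < x -> limit_fun x = x `^ rho * p x.
Proof. by rewrite /limit_fun => ->. Qed.

Lemma limit_fun_gt0 x : 0 < x -> 0 < limit_fun x.
Proof. by move=> x0; rewrite limit_funE// mulr_gt0 ?powR_gt0 ?p0. Qed.

Lemma limit_fun_right_continuous x : 0 < x ->
  limit_fun y @[y --> x^'+] --> limit_fun x.
Proof.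
move=> x0; rewrite limit_funE//.
apply: (@cvg_trans _ ((y `^ rho * p y) @[y --> x^'+])).
  apply: near_eq_cvg; near=> y; rewrite limit_funE//.
  by apply: (lt_trans x0); near: y; exact: nbhs_right_gt.
apply: cvgM; last exact: prc.
by apply: cvg_at_right_filter; exact: continuous_powR.
Unshelve. all: by end_near. Qed.

Lemma limit_fun_continuous x : 0 < x -> {for x, continuous p} ->
  {for x, continuous limit_fun}.
Proof.
move=> x0 cp; rewrite /prop_for /continuous_at limit_funE//.
apply: (@cvg_trans _ ((y `^ rho * p y) @[y --> x])).
  apply: near_eq_cvg; near=> y; rewrite limit_funE//.
  by near: y; exact: lt_nbhsr.
exact: (cvgM (@continuous_powR _ rho _ x0) cp).
Unshelve. all: by end_near. Qed.

Lemma limit_fun_scale x : 0 <= x -> limit_fun (r * x) = r `^ rho * limit_fun x.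
Proof.
rewrite le_eqVlt => /orP[/eqP<-|x0]; first by rewrite mulr0 /limit_fun ltxx mulr0.
rewrite !limit_funE// ?mulr_gt0// powRM ?ltW// -mulrA; congr (_ * (_ * _)).
by rewrite (mulrC r); case: Hp => _ _ _ _ ->.
Qed.

End LimitFunction.

(** * Monotonicity of the limit and domination of the rescaled functions *)

Section Abelian.
Context {R : realType}.
Variables (U l : R -> R) (rho r : R) (p : R -> R).
Hypotheses (HU : nondecreasing_nonneg U) (r1 : 1 < r)
  (sl : slowly_varying l) (Hp : calP r p)
  (Hgrowth : log_periodic_growth U l r rho p).

Let r0 : 0 < r := lt_trans ltr01 r1.
Let prc x : 0 < x -> p y @[y --> x^'+] --> p x.
Proof. by case: Hp => _ _ + _ _; exact. Qed.
Local Notation V := (rescaled U l rho r).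
Local Notation F := (limit_fun rho p).
Local Notation c := (norming l rho r).
Local Notation D := [set x : R | 0 < x /\ ~ {for x, continuous p}].

Let HV n : nondecreasing_nonneg (V n) := rescaled_nondecreasing rho HU r1 sl n.
Let rn0 n : 0 < r ^+ n := exprn_gt0 n r0.
Let c0 n : 0 < c n := norming_gt0 rho r1 sl n.
Let cD : countable D := right_continuous_discontinuity_countable prc.

Lemma rescaled_cvg x : 0 < x -> {for x, continuous p} -> V n x @[n --> \oo] --> F x.
Proof.
move=> x0 cp; rewrite limit_funE//.
by apply/(growth_rescaled U rho r1 sl) => //; exact: Hgrowth.
Qed.

Lemma limit_fun_le x y : 0 < x -> x <= y -> F x <= F y.
Proof.
move=> x0 xy; have y0 : 0 < y := lt_le_trans x0 xy.
(* With the ratio [a] fixed, the claim compares two right-continuous functions of one variable. It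
   suffices to prove it where [p] and its dilation by [a] are both continuous, and there it is
   inherited from [U]. *)
pose a := y / x; have a0 : 0 < a by rewrite divr_gt0.
have a1 : 1 <= a by rewrite ler_pdivlMr// mul1r.
have -> : y = a * x by rewrite /a divfK// gt_eqF.
have arc z : 0 < z -> p (a * w) @[w --> z^'+] --> p (a * z).
  by move=> z0; apply: right_continuous_scale => //; apply: prc; rewrite mulr_gt0.
have cDa := right_continuous_discontinuity_countable arc.
apply: (@right_continuous_le _ F (fun z => F (a * z))
  (D `|` [set x | 0 < x /\ ~ {for x, continuous (fun w => p (a * w))}])) => //.
- by rewrite -bigcup2E; apply: bigcup_countable => // -[|[|n]] _ //=.
- by move=> z z0; exact: (limit_fun_right_continuous Hp z0).
- move=> z z0; apply: right_continuous_scale => //.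
  by apply: (limit_fun_right_continuous Hp); rewrite mulr_gt0.
move=> z z0 /not_orP[/not_andP[//|/contrapT cp] /not_andP[//|/contrapT cpa]].
have az0 : 0 < a * z by rewrite mulr_gt0.
have V1 := rescaled_cvg z0 cp.
have V2 := rescaled_cvg az0 (continuous_scale a0 cpa).
apply: (ler_cvg_to V1 V2); apply: nearW => n.
by rewrite (nondecreasing_nonneg_le (HV n))// ?(ltW z0)// ler_peMl// ltW.
Qed.

Lemma limit_fun_nondecreasing : nondecreasing_nonneg F.
Proof.
split; last by rewrite /limit_fun ltxx.
move=> x y; rewrite !in_itv/= !andbT le_eqVlt => /orP[/eqP<- y0 _|x0 _].
  rewrite {1}/limit_fun ltxx; case: (ltP 0 y) => [y0'|yle0].
    exact: (ltW (limit_fun_gt0 rho Hp y0')).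
  by rewrite /limit_fun ltNge yle0.
exact: limit_fun_le.
Qed.

(* Any m > rho works, as the ratio tends to r `^ rho. *)
Lemma eventually_le_expn z : 0 < z -> {for z, continuous p} ->
  exists m : nat, \forall n \near \oo, U (r ^+ n.+1 * z) <= r ^+ m * U (r ^+ n * z).
Proof.
move=> z0 cz; pose m := (Num.trunc rho).+2; exists m.
have Vz := rescaled_cvg z0 cz; have F0 := limit_fun_gt0 rho Hp z0.
have rm : r `^ rho < r ^+ m.
  apply: (@le_lt_trans _ _ (r ^+ (Num.trunc rho).+1)); last by rewrite ltr_eXn2l.
  rewrite -powR_mulrn; last exact: ltW.
  by rewrite ler_powR ?ltW// truncnS_gt.
have H : V n.+1 z * (c n.+1 / c n) - r ^+ m * V n z @[n --> \oo] -->
    F z * r `^ rho - r ^+ m * F z.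
  apply: cvgB; last by apply: cvgM => //; exact: cvg_cst.
  by apply: cvgM; [rewrite (cvg_shiftS (V ^~ z))|exact: normingS_cvg].
have neg : F z * r `^ rho - r ^+ m * F z < 0.
  by rewrite mulrC -mulrBl nmulr_rlt0 ?subr_lt0.
apply: filterS (cvgr_lt _ H _ neg) => n.
have -> : V n.+1 z * (c n.+1 / c n) = (c n)^-1 * U (r ^+ n.+1 * z).
  by rewrite /rescaled; field; rewrite !gt_eqF.
by rewrite /rescaled mulrCA -mulrBr pmulr_rlt0 ?invr_gt0// subr_lt0 => /ltW.
Qed.

(** The index after which the one-step bound holds does not depend on the number of steps. Iterating
    it gives V_n(r^k z) <= r^(m k) V_n(z), hence growth of order x^m uniformly in n. *)
Lemma rescaled_subexponential : subexponential V.
Proof.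
move=> d d0.
have [z /andP[z0 z1] nDz] := countable_compl_dense cD (ltr01 : (0 : R) < 1).
have cz : {for z, continuous p} by apply: contrapT => nc; apply: nDz.
have [m [N1 _ N1P]] := eventually_le_expn z0 cz.
have Vz := rescaled_cvg z0 cz; have F0 := limit_fun_gt0 rho Hp z0.
have [N2 _ N2P] : \forall n \near \oo, V n z <= F z + 1.
  by apply: (cvgr_le _ Vz); rewrite ltrDl.
have step n k : (N1 <= n)%N -> U (r ^+ (n + k) * z) <= r ^+ (m * k) * U (r ^+ n * z).
  move=> Nn; elim: k => [|k IH]; first by rewrite addn0 muln0 expr0 mul1r.
  have nk : (N1 <= n + k)%N by rewrite (leq_trans Nn)// leq_addr.
  rewrite addnS; apply: (le_trans (N1P _ nk)).
  by rewrite mulnS (exprD r m) -(mulrA (r ^+ m)) ler_wpM2l// exprn_ge0// ltW.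
have [C1 C10 C1P] := exprn_le_expR m d0.
have Fz1 : 0 < F z + 1 by rewrite addr_gt0.
(* The summand 1 serves x <= z. If x > z, then x <= r^(k+1) z with r^k <= x / z, so the factor r^(m
   (k+1)) is at most r^m (x / z)^m, and x^m <= C1 exp(d x). *)
exists ((F z + 1) * (1 + r ^+ m * C1 / z ^+ m)); exists (maxn N1 N2) => // n.
rewrite /= geq_max => /andP[n1 n2] x x0.
have Vn : V n z <= F z + 1 := N2P _ n2.
have e1 : 1 <= expR (d * x) by rewrite -expR0 ler_expR mulr_ge0// ltW.
have K0 : 0 <= r ^+ m * C1 / z ^+ m by rewrite !mulr_ge0 ?invr_ge0 ?exprn_ge0 ?ltW.
have [xz|zx] := leP x z.
  apply: (le_trans (nondecreasing_nonneg_le (HV n) x0 xz)).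
  apply: (le_trans Vn); rewrite -mulrA ler_peMr ?(ltW Fz1)//.
  by rewrite mulrDl mul1r (le_trans e1)// lerDl mulr_ge0 ?expR_ge0.
have [k [u [/andP[u1 ur] xE]]] : exists k u, 1 <= u <= r /\ x / z = r ^+ k * u.
  by apply: scale_decomposition => //; rewrite ler_pdivlMr// mul1r ltW.
have xk : x <= r ^+ k.+1 * z.
  rewrite -ler_pdivrMr// xE exprSr ler_wpM2l// exprn_ge0// ltW//.
apply: (le_trans (nondecreasing_nonneg_le (HV n) x0 xk)).
have B1 : V n (r ^+ k.+1 * z) <= r ^+ (m * k.+1) * (F z + 1).
  apply: (@le_trans _ _ (r ^+ (m * k.+1) * V n z)).
    rewrite /rescaled mulrA -exprD [leRHS]mulrCA ler_wpM2l ?invr_ge0 ?(ltW (c0 n))//.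
    exact: step.
  by rewrite ler_wpM2l// exprn_ge0// ltW.
apply: (le_trans B1); rewrite mulrC -[leRHS]mulrA ler_wpM2l ?(ltW Fz1)//.
have B2 : (r ^+ k) ^+ m <= (x / z) ^+ m.
  have rk : 0 <= r ^+ k by rewrite exprn_ge0// ltW.
  have u0 : 0 <= u := le_trans ler01 u1.
  by rewrite xE lerXn2r ?nnegrE ?mulr_ge0// ler_peMr.
rewrite mulnS (exprD r m) mulnC exprM mulrDl mul1r.
apply: (@le_trans _ _ (r ^+ m * (x / z) ^+ m)).
  by rewrite ler_wpM2l// exprn_ge0// ltW.
apply: (@le_trans _ _ (r ^+ m * C1 / z ^+ m * expR (d * x))); last by rewrite lerDr expR_ge0.
rewrite expr_div_n -!mulrA ler_wpM2l ?exprn_ge0 ?(ltW r0)//.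
by rewrite [leLHS]mulrC [leRHS]mulrCA ler_wpM2l ?invr_ge0 ?exprn_ge0 ?(ltW z0)// C1P.
Qed.

Lemma abel_cvg t : 0 < t ->
  (laplace F t < +oo)%E /\ laplace (V n) t @[n --> \oo] --> laplace F t.
Proof.
move=> t0; have [|iF cF] := cvg_laplace HV limit_fun_nondecreasing
  rescaled_subexponential cD _ t0.
  move=> x x0 nDx; apply: rescaled_cvg => //.
  by apply: contrapT => nc; apply: nDx.
split => //; have /integrableP[_] := iF; congr (_ < _)%E.
apply: eq_integral => x; rewrite inE => x0.
by rewrite gee0_abs// lee_fin laplace_integrand_ge0//; exact: limit_fun_nondecreasing.
Qed.

Lemma limit_fun_finite : laplace_finite F.
Proof. by move=> t t0; have [] := abel_cvg t0. Qed.

(** One rescaled function is enough: the transform of V_N at r^N s is a positive multiple of that of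
    [U] at s, and the growth rate s/2 of V_N is below r^N s. *)
Lemma growth_laplace_finite : laplace_finite U.
Proof.
move=> s s0; have s20 : 0 < s / 2 by rewrite divr_gt0.
have [C [N _ NC]] := rescaled_subexponential s20.
have sN : s / 2 < r ^+ N * s.
  rewrite (@lt_le_trans _ _ s)//; first lra.
  by rewrite ler_peMl ?(ltW s0)// exprn_ege1// ltW.
have /integrableP[_] := integrable_laplace_bound (HV N) sN (NC _ (leqnn _)).
rewrite [ltLHS](_ : _ = laplace (V N) (r ^+ N * s)); last first.
  apply: eq_integral => x; rewrite inE => x0.
  by rewrite gee0_abs// lee_fin laplace_integrand_ge0.
rewrite laplace_rescaled// (mulrC _ s) mulfK ?gt_eqF//.
have : (0 < ((c N)^-1 / r ^+ N)%:E)%E by rewrite lte_fin divr_gt0// invr_gt0.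
move: (laplace U s) (laplace_ge0 s HU) => [u| |] //= _ A.
  by move=> _; exact: ltry.
by rewrite gt0_muley.
Qed.

End Abelian.

(** * The transform of the limit function and the uniqueness of q *)

Section AbelianTheorem.
Context {R : realType}.
Variables (U l : R -> R) (rho r : R) (p : R -> R).
Hypotheses (HU : nondecreasing_nonneg U) (rho0 : 0 <= rho) (r1 : 1 < r)
  (sl : slowly_varying l) (Hp : calP r p)
  (Hgrowth : log_periodic_growth U l r rho p).

Let r0 : 0 < r := lt_trans ltr01 r1.
Local Notation V := (rescaled U l rho r).
Local Notation F := (limit_fun rho p).
Local Notation c := (norming l rho r).

Let HV n : nondecreasing_nonneg (V n) := rescaled_nondecreasing rho HU r1 sl n.
Let rn0 n : 0 < r ^+ n := exprn_gt0 n r0.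
Let HF : nondecreasing_nonneg F := limit_fun_nondecreasing HU r1 sl Hp Hgrowth.
Local Notation fF := (limit_fun_finite HU r1 sl Hp Hgrowth).
Local Notation fU := (growth_laplace_finite HU r1 sl Hp Hgrowth).
Let l0 x : 0 < x -> 0 < l x. Proof. by case: sl => + _ _; exact. Qed.

Local Notation Lam := (real_laplace F).

Let LamE t : 0 < t -> (Lam t)%:E = laplace F t.
Proof. exact: (real_laplaceE HF fF). Qed.

Let Lam_le s t : 0 < s -> s <= t -> Lam t <= Lam s.
Proof. exact: (real_laplace_nonincreasing HF fF). Qed.

Let Lam_gt0 t : 0 < t -> 0 < Lam t.
Proof.
move=> t0; have := laplace_tail_bound HF t0 ler01.
rewrite -LamE// -EFinM lee_fin => H.
rewrite -(pmulr_rgt0 _ t0) (lt_le_trans _ H)// mulr_gt0 ?expR_gt0//.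
exact: (limit_fun_gt0 rho Hp).
Qed.

(** The real-valued form of [opA], through the Lebesgue integral of [limit_fun]. It also serves rho
    = 0, where it reduces to the constant [p]. *)
Definition abel_fun s : R := s `^ rho * (s * real_laplace (limit_fun rho p) s).

Lemma abel_fun_gt0 s : 0 < s -> 0 < abel_fun s.
Proof. by move=> s0; rewrite !mulr_gt0 ?powR_gt0 ?Lam_gt0. Qed.

Lemma abel_fun_stieltjes s : 0 < s ->
  (s `^ (- rho) * abel_fun s)%:E = laplace_stieltjes F s.
Proof.
move=> s0; rewrite laplace_stieltjesE// -LamE// -EFinM /abel_fun powRN.
by rewrite mulKf// gt_eqF// powR_gt0.
Qed.

Let Lam_continuous s : 0 < s -> {for s, continuous Lam}.
Proof.
move=> s0; pose h z := z * Lam z.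
have hE z : 0 < z -> (h z)%:E = laplace_stieltjes F z.
  by move=> z0; rewrite laplace_stieltjesE// -LamE.
have [dh _] := derive1n_stieltjes_moment HF fF hE 0 s0.
have ch : {for s, continuous h} by apply: differentiable_continuous; apply/derivable1_diffP.
(* Division by 0 gives 0, so [h z / z] need not be [Lam z] at z = 0; the difference is carried along
   as a term that vanishes near [s]. *)
have -> : Lam = (fun z => h z / z) \- (fun z => h z / z - Lam z).
  by apply/funext => z /=; rewrite opprB addrC subrK.
rewrite /prop_for /continuous_at /=.
have E z : 0 < z -> h z / z - Lam z = 0.
  by move=> z0; rewrite /h mulrAC mulfV ?gt_eqF// mul1r subrr.
apply: cvgB.
  by apply: cvgM => //; apply: cvgV; [rewrite gt_eqF|exact: cvg_id].
rewrite E//; apply: cvg_near_cst; near=> z; apply: E.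
by near: z; exact: lt_nbhsr.
Unshelve. all: by end_near. Qed.

Lemma abel_fun_continuous s : 0 < s -> {for s, continuous abel_fun}.
Proof.
move=> s0; exact: (cvgM (@continuous_powR _ rho _ s0) (cvgM cvg_id (Lam_continuous s0))).
Qed.

Lemma abel_fun_periodic s : 0 < s -> abel_fun (s * r) = abel_fun s.
Proof.
move=> s0; rewrite /abel_fun powRM ?ltW//.
have sr0 : 0 < s * r by rewrite mulr_gt0.
have rr := powR_gt0 rho r0.
suff -> : Lam s = r `^ rho * r * Lam (s * r) by ring.
apply/eqP; rewrite -eqe EFinM !LamE//; apply/eqP.
have E : laplace F (s * r) = laplace (fun x => (r `^ rho)^-1 * F (r * x)) (s * r).
  rewrite /laplace; apply: eq_integral => x; rewrite inE/= in_itv/= andbT => x0.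
  by rewrite (limit_fun_scale rho r1 Hp x0) mulKf// gt_eqF.
rewrite E laplace_scale ?invr_ge0 ?ltW// mulfK ?gt_eqF// muleA -EFinM.
rewrite (_ : _ * _ = 1) ?mul1e//.
by field; rewrite !gt_eqF.
Qed.

Lemma calP_abel_fun : calP r abel_fun.
Proof.
(* On [1, r] the factor s^rho s lies between 1 and r^rho r, and the nonincreasing [Lam] between
   [Lam r] and [Lam 1]. *)
apply: (@calP_of_bounds _ _ (Lam r) (r `^ rho * (r * Lam 1))) => //.
- exact: Lam_gt0.
- move=> u /andP[u1 ur]; have u0 : 0 < u := lt_le_trans ltr01 u1.
  have ru1 : 1 <= u `^ rho by have := ler_powR u1 rho0; rewrite powRr0.
  have rur : u `^ rho <= r `^ rho by rewrite ge0_ler_powR ?nnegrE// ltW.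
  rewrite /abel_fun; apply/andP; split.
    apply: (@le_trans _ _ (Lam u)); first exact: Lam_le.
    rewrite mulrA ler_peMl ?(ltW (Lam_gt0 u0))//.
    by rewrite mulr_ege1.
  have Lu := ltW (Lam_gt0 u0).
  apply: ler_pM; rewrite ?powR_ge0 ?mulr_ge0 ?(ltW u0)//.
  by apply: ler_pM; rewrite ?(ltW u0)// Lam_le.
- move=> x x0; apply: cvg_at_right_filter; exact: abel_fun_continuous.
- by move=> x x0; exact: abel_fun_periodic.
Qed.

Local Notation Lamn n := (real_laplace (V n)).

Let LamnE n t : 0 < t -> (Lamn n t)%:E = laplace (V n) t.
Proof. exact: (real_laplaceE (HV n) (laplace_finite_rescaled rho HU r1 sl fU n)). Qed.

Let Lamn_uniform e : 0 < e -> \forall n \near \oo, forall t, r^-1 <= t <= 1 ->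
  `|Lamn n t / Lam t - 1| < e.
Proof.
(* [Lam 1] is the least value of [Lam] on [1/r, 1], so an absolute error e [Lam 1] is a relative
   error e. The signs below turn nonincreasing transforms into nondecreasing functions. *)
move=> e0; have e1 : 0 < e * Lam 1 by rewrite mulr_gt0// Lam_gt0.
have rV0 : 0 < r^-1 by rewrite invr_gt0.
have := @uniform_cvg_monotone R (fun n t => - Lamn n t) (fun t => - Lam t) r^-1 1 _ rV0 _ _ _ e1.
move=> /(_ _ _ _) H; apply: filterS (H _ _ _).
- move=> n nP t /andP[rt t1]; have t0 : 0 < t := lt_le_trans rV0 rt.
  have := nP t; rewrite rt t1 => /(_ isT).
  rewrite opprK addrC distrC => nt.
  rewrite (_ : _ - 1 = (Lamn n t - Lam t) / Lam t); last first.
    by field; rewrite gt_eqF// Lam_gt0.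
  rewrite normrM normfV (gtr0_norm (Lam_gt0 t0)) ltr_pdivrMr ?Lam_gt0//.
  rewrite (lt_le_trans nt)// ler_wpM2l ?(ltW e0)// Lam_le//.
- move=> n x y x0 xy; have y0 := lt_le_trans x0 xy.
  by rewrite lerN2 -lee_fin !LamnE// laplace_nonincreasing.
- move=> x x0; apply: cvgN; apply: (cvg_real_laplace HF fF) => //.
  by have [] := abel_cvg HU r1 sl Hp Hgrowth x0.
- by move=> x x0; apply: cvgN; exact: Lam_continuous.
Qed.

Definition laplace_ratio s : R :=
  fine (laplace_stieltjes U s) / (s `^ (- rho) * l (1 / s) * abel_fun s).

(** Separates a ratio of transforms from a ratio of values of [l]; each is close to 1 uniformly for
    u in [1, r], but for different reasons. *)
Let laplace_ratioE n u : 1 <= u ->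
  laplace_ratio (r ^+ n * u)^-1 =
  (Lamn n u^-1 / Lam u^-1) * (l (r ^+ n * u) / l (r ^+ n))^-1.
Proof.
move=> u1; have u0 : 0 < u := lt_le_trans ltr01 u1.
have t0 : 0 < u^-1 by rewrite invr_gt0.
have nu0 : 0 < r ^+ n * u by rewrite mulr_gt0.
have sE : (r ^+ n * u)^-1 = u^-1 / r ^+ n by rewrite invfM mulrC.
have qE : abel_fun (r ^+ n * u)^-1 = abel_fun u^-1.
  rewrite -(@periodic_expn _ _ abel_fun n (r ^+ n * u)^-1 r0 abel_fun_periodic) ?invr_gt0//.
  by rewrite invfM mulVKf// gt_eqF.
rewrite /laplace_ratio qE {1}sE (laplace_stieltjes_rescaled rho HU r1 sl)//.
rewrite -LamnE// -EFinM /= div1r invrK.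
have pwV x : 0 < x -> (x^-1) `^ rho = (x `^ rho)^-1.
  move=> x0; have xr := powR_gt0 rho x0.
  apply: (mulfI (lt0r_neq0 xr)); rewrite mulfV ?gt_eqF//.
  by rewrite -powRM ?invr_ge0 ?ltW// mulfV ?gt_eqF// powR1.
rewrite powRN pwV// invrK /abel_fun pwV// powRM ?ltW// /norming.
have := l0 nu0; have := l0 (rn0 n); have := Lam_gt0 t0.
have := powR_gt0 rho u0; have := powR_gt0 rho (rn0 n).
move: (Lam _) (Lamn _ _) (l (r ^+ n * u)) (l (r ^+ n)) (u `^ rho) ((r ^+ n) `^ rho).
by move=> a b c' d e f f0 e0 a0 d0 c0'; field; rewrite !gt_eqF.
Qed.

Lemma laplace_ratio_cvg : laplace_ratio s @[s --> 0^'+] --> (1 : R).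
Proof.
have H : (laplace_ratio x^-1) @[x --> +oo] --> (1 : R).
  apply: (cvg_geometric_uniform r1) => e e0.
  have [d1 d10 M] := near1_mul e0; have [d2 d20 I] := near1_inv d10.
  apply: filterS2 (Lamn_uniform d10) (slow_ratio_uniform r1 sl d20).
  move=> n P1 P2 u /andP[u1 ur]; have u0 : 0 < u := lt_le_trans ltr01 u1.
  rewrite laplace_ratioE//; apply: M; last by apply: I; apply: P2; rewrite u1.
  by apply: P1; rewrite lef_pV2 ?posrE// ur invf_le1.
have inv_cvg : (x^-1 : R) @[x --> 0^'+] --> +oo.
  apply/gtr0_cvgV0; first by near=> x; rewrite invr_gt0.
  rewrite (_ : unstable.inv_fun _ = id); last by apply/funext => x; rewrite /= invrK.
  by apply: cvg_at_right_filter; exact: cvg_id.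
have := cvg_comp _ _ inv_cvg H; apply: cvg_trans; apply: near_eq_cvg.
by apply: nearW => x /=; rewrite invrK.
Unshelve. all: by end_near. Qed.

Lemma log_periodic_laplace_abel_fun : log_periodic_laplace U l rho abel_fun.
Proof.
rewrite /log_periodic_laplace.
apply: (@cvg_trans _ ((laplace_ratio s)%:E @[s --> 0^'+])); last first.
  by apply: cvg_EFin; [exact: nearW|exact: laplace_ratio_cvg].
apply: near_eq_cvg; near=> s; have s0 : 0 < s by [].
have LSfin : laplace_stieltjes U s \is a fin_num.
  rewrite laplace_stieltjesE// fin_numM// ge0_fin_numE ?laplace_ge0//; exact: fU.
by rewrite /laplace_ratio -[in RHS](fineK LSfin) -EFinM.
Unshelve. all: by end_near. Qed.

(** Along s / r^n both functions keep their value at s. The transform divided by either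
    normalisation tends to 1, so the constant quotient q(s) / [abel_fun](s) is 1. *)
Lemma abel_fun_unique q s : calP r q -> log_periodic_laplace U l rho q ->
  0 < s -> q s = abel_fun s.
Proof.
move=> Hq Hl s0; have q0 : 0 < q s by case: Hq => + _ _ _ _; exact.
have qr : forall x, 0 < x -> q (x * r) = q x by case: Hq.
have a0 := abel_fun_gt0 s0.
have scvg := cvg_div_expn_right r1 s0.
have L1 := cvg_comp _ _ scvg Hl.
have L2 := cvg_comp _ _ scvg log_periodic_laplace_abel_fun.
have perE (f : R -> R) : (forall x, 0 < x -> f (x * r) = f x) -> forall n, f (s / r ^+ n) = f s.
  move=> fr n; have sn0 : 0 < s / r ^+ n by rewrite divr_gt0.
  by rewrite -(periodic_expn n r0 fr sn0) mulrC divfK// gt_eqF.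
pose g n := (laplace_stieltjes U (s / r ^+ n) * (((s / r ^+ n) `^ (- rho) *
  l (1 / (s / r ^+ n)) * q (s / r ^+ n))^-1)%:E)%E.
pose h n := ((q s)%:E * g n * ((abel_fun s)^-1)%:E)%E.
have L3 : h n @[n --> \oo] --> ((q s)%:E * 1 * ((abel_fun s)^-1)%:E)%E.
  by apply: cvgeZr => //; apply: cvgeZl.
have mE (X : \bar R) (a b d : R) : (a%:E * (X * b%:E) * d%:E = X * (a * b * d)%:E)%E.
  by rewrite muleCA -muleA -!EFinM.
have L4 : h n @[n --> \oo] --> 1%E.
  apply: cvg_trans L2; apply: near_eq_cvg; apply: nearW => n.
  rewrite /h /g /= (perE q qr) (perE abel_fun) //; last first.
    by move=> x x0; exact: abel_fun_periodic.
  rewrite mE; congr (_ * _%:E)%E.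
  have sn0 : 0 < s / r ^+ n by rewrite divr_gt0.
  have := powR_gt0 (- rho) sn0; have : 0 < l (1 / (s / r ^+ n)) by rewrite l0// divr_gt0.
  move: (l _) (_ `^ _) => b a b0 a0'.
  by field; rewrite !gt_eqF.
have E : ((q s)%:E * 1 * ((abel_fun s)^-1)%:E)%E = 1%E.
  exact: (cvg_unique (@ereal_hausdorff R) L3 L4).
have {}E : q s / abel_fun s = 1 by apply: EFin_inj; rewrite -[RHS]E mule1 EFinM.
by rewrite -[q s](divfK (lt0r_neq0 a0)) E mul1r.
Qed.

End AbelianTheorem.

(** * The shape of p, the case rho = 0, and continuous p *)

Section AbelianConsequences.
Context {R : realType}.
Variables (U l : R -> R) (rho r : R) (p : R -> R).
Hypotheses (HU : nondecreasing_nonneg U) (r1 : 1 < r)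
  (sl : slowly_varying l) (Hp : calP r p)
  (Hgrowth : log_periodic_growth U l r rho p).

Let r0 : 0 < r := lt_trans ltr01 r1.
Local Notation V := (rescaled U l rho r).
Local Notation F := (limit_fun rho p).

Let HV n : nondecreasing_nonneg (V n) := rescaled_nondecreasing rho HU r1 sl n.
Let rn0 n : 0 < r ^+ n := exprn_gt0 n r0.
Let HF : nondecreasing_nonneg F := limit_fun_nondecreasing HU r1 sl Hp Hgrowth.
Let l0 x : 0 < x -> 0 < l x. Proof. by case: sl => + _ _; exact. Qed.

Lemma growth_calP_rho : calP_rho r rho p.
Proof.
split=> // x y; rewrite !in_itv/= !andbT => x0 y0 xy.
by have := limit_fun_le HU r1 sl Hp Hgrowth x0 xy; rewrite !limit_funE.
Qed.

Lemma opA_abel_fun s : 0 < rho -> 0 < s -> (abel_fun rho p s)%:E = opA rho p s.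
Proof.
move=> rho_gt0 s0; have rho_neq0 : rho != 0 by rewrite gt_eqF.
have E x : 0 <= x -> p x * x `^ rho = F x.
  rewrite le_eqVlt => /orP[/eqP<-|x0]; last by rewrite limit_funE// mulrC.
  by rewrite powR0// mulr0 /limit_fun ltxx.
have Hf : nondecreasing_nonneg (fun x => p x * x `^ rho).
  split; last by rewrite E// HF.2.
  move=> x y x0 y0 xy; move: (x0) (y0); rewrite !in_itv/= !andbT => x0' y0'.
  by rewrite !E//; exact: HF.1.
rewrite /opA laplace_stieltjesE// (laplace_eq_pos _ Hf HF); last first.
  by move=> x x0; rewrite E// ltW.
rewrite -laplace_stieltjesE// -(abel_fun_stieltjes HU r1 sl Hp Hgrowth)// -EFinM.
by rewrite powRN mulVKf// gt_eqF// powR_gt0.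
Qed.

(** For rho = 0 the function [p] is itself nondecreasing, and p(y) <= p(r^k z) = p(z) for all y and
    z once k is large. *)
Lemma limit_constant x : rho = 0 -> 0 < x -> p x = p 1.
Proof.
move=> rho00.
have pr : forall x, 0 < x -> p (x * r) = p x by case: Hp.
have mono y z : 0 < y -> y <= z -> p y <= p z.
  move=> y0 yz; have := limit_fun_le HU r1 sl Hp Hgrowth y0 yz.
  by rewrite !limit_funE ?(lt_le_trans y0)// rho00 !powRr0 !mul1r.
have le y z : 0 < y -> 0 < z -> p y <= p z.
  move=> y0 z0; have [k kP] := expn_unbounded (y / z) r1.
  rewrite -(periodic_expn k r0 pr z0) mono// -ler_pdivrMr//; exact: ltW.
by move=> x0; apply/eqP; rewrite eq_le !le.
Qed.

Lemma abel_fun_constant s : rho = 0 -> 0 < s -> abel_fun rho p s = p s.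
Proof.
move=> rho00 s0; have p10 : 0 < p 1 by case: Hp => + _ _ _ _; apply.
have Hc : nondecreasing_nonneg (fun=> p 1) by split => //; exact: ltW.
rewrite /abel_fun (limit_constant rho00 s0) {1}rho00 powRr0 mul1r.
suff E : laplace F s = (p 1 / s)%:E.
  have -> : real_laplace F s = p 1 / s.
    apply: EFin_inj.
    by rewrite (real_laplaceE HF (limit_fun_finite HU r1 sl Hp Hgrowth)).
  by rewrite mulrC divfK// gt_eqF.
rewrite (laplace_eq_pos _ HF Hc); last first.
  by move=> x x0; rewrite limit_funE// (limit_constant rho00 x0) rho00 powRr0 mul1r.
have := integral_expRN_tail 0 s0; rewrite mulr0 oppr0 expR0.
under eq_integral do rewrite EFinM.
rewrite ge0_integralZl_EFin//=; last 2 first.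
- by apply/measurable_EFinP; exact: measurable_expRN.
- exact: ltW.
move=> E; rewrite /laplace; under eq_integral do rewrite mulrC EFinM.
rewrite ge0_integralZl_EFin//=; last 2 first.
- by apply/measurable_EFinP; exact: measurable_expRN.
- exact: ltW.
have s1 : (s^-1 * s)%:E = 1%E :> \bar R by rewrite mulVf// gt_eqF.
by rewrite EFinM -[X in (_ * X)%E = _]mul1e -s1 EFinM -[X in (_ * X)%E = _]muleA E mule1.
Qed.

(** With [p] continuous the monotone V_n converge to F uniformly on [1, r]. The error is relative
    because F >= F(1) > 0 there, and [l] contributes a separate ratio. *)
Lemma growth_continuous :
  (forall z, 0 < z -> {for z, continuous p}) ->
  U x / (x `^ rho * l x * p x) @[x --> +oo] --> (1 : R).
Proof.
move=> cp; have p0 x : 0 < x -> 0 < p x by case: Hp => + _ _ _ _; exact.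
have pr : forall x, 0 < x -> p (x * r) = p x by case: Hp.
have F1 := limit_fun_gt0 rho Hp (ltr01 : (0 : R) < 1).
have unif e : 0 < e -> \forall n \near \oo, forall u, 1 <= u <= r -> `|V n u / F u - 1| < e.
  move=> e0; have e1 : 0 < e * F 1 by rewrite mulr_gt0.
  have := @uniform_cvg_monotone R V F 1 r _ ltr01 _ _ _ e1.
  move=> /(_ _ _ _) H; apply: filterS (H _ _ _).
  - move=> n nP u /andP[u1 ur]; have u0 : 0 < u := lt_le_trans ltr01 u1.
    have Fu := limit_fun_gt0 rho Hp u0.
    have := nP u; rewrite u1 ur => /(_ isT) nu.
    rewrite (_ : _ - 1 = (V n u - F u) / F u); last by field; rewrite gt_eqF.
    rewrite normrM normfV (gtr0_norm Fu) ltr_pdivrMr// (lt_le_trans nu)//.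
    by rewrite ler_wpM2l ?(ltW e0)// (nondecreasing_nonneg_le HF).
  - by move=> n x y x0 xy; rewrite (nondecreasing_nonneg_le (HV n))// ltW.
  - by move=> x x0; apply: (rescaled_cvg r1 sl Hgrowth) => //; exact: cp.
  - by move=> x x0; apply: limit_fun_continuous => //; exact: cp.
apply: (cvg_geometric_uniform r1) => e e0.
have [d1 d10 M] := near1_mul e0; have [d2 d20 I] := near1_inv d10.
apply: filterS2 (unif _ d10) (slow_ratio_uniform r1 sl d20) => n P1 P2 u ur.
have /andP[u1 _] := ur; have u0 : 0 < u := lt_le_trans ltr01 u1.
rewrite (_ : _ / _ = V n u / F u * (l (r ^+ n * u) / l (r ^+ n))^-1).
  by apply: M; [exact: P1|apply: I; exact: P2].
rewrite (periodic_expn n r0 pr u0) limit_funE//.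
rewrite -[LHS]/(U _ * _) invfM mulrA growth_rescaledE//.
have := p0 _ u0; have := powR_gt0 rho u0; have := l0 (rn0 n).
have : 0 < l (r ^+ n * u) by rewrite l0// mulr_gt0.
move: (V n u) (l _) (l _) (_ `^ _) (p u) => a b c' d e' b0 c'0 d0 e'0.
by field; rewrite !gt_eqF.
Qed.

End AbelianConsequences.

(** * From the transform to the growth of U *)

Section Tauberian.
Context {R : realType}.
Variables (U l : R -> R) (rho r : R) (q : R -> R).
Hypotheses (HU : nondecreasing_nonneg U) (rho0 : 0 <= rho) (r1 : 1 < r)
  (sl : slowly_varying l) (Hq : calP r q)
  (Hl : log_periodic_laplace U l rho q).

Let r0 : 0 < r := lt_trans ltr01 r1.
Local Notation V := (rescaled U l rho r).
Local Notation c := (norming l rho r).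

Let HV n : nondecreasing_nonneg (V n) := rescaled_nondecreasing rho HU r1 sl n.
Let rn0 n : 0 < r ^+ n := exprn_gt0 n r0.
Let c0 n : 0 < c n := norming_gt0 rho r1 sl n.
Let l0 x : 0 < x -> 0 < l x. Proof. by case: sl => + _ _; exact. Qed.
Let q0 x : 0 < x -> 0 < q x. Proof. by case: Hq => + _ _ _ _; exact. Qed.
Let qr x : 0 < x -> q (x * r) = q x. Proof. by case: Hq => _ _ _ _; exact. Qed.

(** Finiteness at one small argument below [s] spreads to [s], as the transform is nonincreasing. *)
Lemma tauber_laplace_finite : laplace_finite U.
Proof.
move=> s s0; have /fine_cvgP[[d/= d0 dP] _] := Hl.
pose s' := Num.min s (d / 2).
have s'0 : 0 < s' by rewrite lt_min s0 divr_gt0.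
have s'd : s' < d by rewrite gt_min; apply/orP; right; lra.
have := dP s'; rewrite /= sub0r normrN gtr0_norm// => /(_ s'd s'0).
rewrite laplace_stieltjesE//.
have ws : 0 < (s' `^ (- rho) * l (1 / s') * q s')^-1.
  by rewrite invr_gt0 !mulr_gt0 ?powR_gt0 ?l0 ?q0 ?divr_gt0.
move=> H; apply: (@le_lt_trans _ _ (laplace U s')).
  by apply: laplace_nonincreasing; rewrite // ge_min lexx.
move: H; move: (laplace U s') (laplace_ge0 s' HU) => [u| |] //= _.
  by move=> _; exact: ltry.
by rewrite gt0_muley ?lte_fin// gt0_mulye ?lte_fin.
Qed.

Local Notation Lamn n := (real_laplace (V n)).

Let LamnE n t : 0 < t -> (Lamn n t)%:E = laplace (V n) t.
Proof.
apply: real_laplaceE => //.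
exact: (laplace_finite_rescaled rho HU r1 sl tauber_laplace_finite).
Qed.

(** Statement (b) read at t / r^n, where q takes the value q(t) and l(r^n / t) may be replaced by
    l(r^n). *)
Lemma tauber_laplace_cvg t : 0 < t ->
  laplace (V n) t @[n --> \oo] --> (t `^ (- rho) * q t / t)%:E.
Proof.
move=> t0; have tV0 : 0 < t^-1 by rewrite invr_gt0.
have := cvg_comp _ _ (cvg_div_expn_right r1 t0) Hl => /fine_cvgP[_ H].
have sr : l (r ^+ n * t^-1) / l (r ^+ n) @[n --> \oo] --> (1 : R).
  exact: slow_ratio_cvg.
suff E : Lamn n t @[n --> \oo] --> t `^ (- rho) * q t / t.
  apply: (@cvg_trans _ ((Lamn n t)%:E @[n --> \oo])).
    by apply: near_eq_cvg; apply: nearW => n; rewrite LamnE.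
  by apply: cvg_EFin; [exact: nearW|exact: E].
have K : 1 * (t `^ (- rho) * q t / t * 1) = t `^ (- rho) * q t / t.
  by rewrite mul1r mulr1.
rewrite -K; apply: cvg_trans (cvgM H (cvgM (cvg_cst (t `^ (- rho) * q t / t)) sr)).
apply: near_eq_cvg; apply: nearW => n /=.
have tn0 : 0 < t / r ^+ n by rewrite divr_gt0.
have qE : q (t / r ^+ n) = q t.
  by rewrite -(periodic_expn n r0 qr tn0) mulrC divfK// gt_eqF.
rewrite (laplace_stieltjes_rescaled rho HU r1 sl)// -LamnE// -!EFinM /= qE.
have -> : 1 / (t / r ^+ n) = r ^+ n * t^-1 by rewrite div1r invf_div.
have pE : (t / r ^+ n) `^ (- rho) = t `^ (- rho) * (r ^+ n) `^ rho.
  have -> : t `^ (- rho) = (t / r ^+ n) `^ (- rho) * (r ^+ n) `^ (- rho).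
    by rewrite -powRM ?ltW// divfK// gt_eqF.
  by rewrite (powRN (r ^+ n)) divfK// gt_eqF// powR_gt0.
rewrite pE /norming.
have lt0 : 0 < l (r ^+ n * t^-1) by rewrite l0// mulr_gt0.
have := l0 (rn0 n); have := powR_gt0 rho (rn0 n); have := powR_gt0 (- rho) t0.
have := q0 t0; move: lt0.
move: (l _) (l _) ((r ^+ n) `^ rho) (t `^ _) (q t) (Lamn n t) => a b c' d e f.
by move=> a0 e0 d0 c'0 b0; field; rewrite !gt_eqF.
Qed.

Lemma tauber_subexponential : subexponential V.
Proof.
apply: subexponential_laplace => // t t0.
exists (t `^ (- rho) * q t / t + 1).
have /fine_cvgP[_ H] := tauber_laplace_cvg t0.
have lt1 : t `^ (- rho) * q t / t < t `^ (- rho) * q t / t + 1 by rewrite ltrDl.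
apply: filterS (cvgr_le _ H _ lt1) => n.
by rewrite /= -LamnE//= lee_fin.
Qed.

(** The infimum of this set is the infimum over y > z of limsup V_n(y). The strict inequality z < y
    is what makes that infimum right-continuous in z. *)
Definition upper_values z : set R :=
  [set a | exists2 y, z < y & \forall n \near \oo, V n y <= a].

Definition tauber_limit z : R := inf (upper_values z).
Local Notation G := tauber_limit.

Let S_nonempty z : 0 <= z -> upper_values z !=set0.
Proof.
move=> z0; have [C CP] := tauber_subexponential ltr01.
exists (C * expR (1 * (z + 1))), (z + 1); first by rewrite ltrDl.
by apply: filterS CP => n; apply; rewrite addr_ge0.
Qed.

Let S_ge0 z a : 0 <= z -> upper_values z a -> 0 <= a.
Proof.
move=> z0 [y zy [N _ NP]]; apply: le_trans (NP N (leqnn _)).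
by rewrite (nondecreasing_nonneg_ge0 (HV N))// (le_trans z0)// ltW.
Qed.

Let S_has_lbound z : 0 <= z -> has_lbound (upper_values z).
Proof. by move=> z0; exists 0 => a; exact: S_ge0. Qed.

Let G_ge0 z : 0 <= z -> 0 <= G z.
Proof. by move=> z0; apply: lb_le_inf => [|a]; [exact: S_nonempty|exact: S_ge0]. Qed.

Let G_adherent z e : 0 <= z -> 0 < e ->
  exists a y, [/\ z < y, \forall n \near \oo, V n y <= a & a < G z + e].
Proof.
move=> z0 e0; have hi : has_inf (upper_values z).
  by split; [exact: S_nonempty|exact: S_has_lbound].
by have [a [y zy Va] aG] := inf_adherent e0 hi; exists a, y.
Qed.

Let G_le z z' : 0 <= z -> z <= z' -> G z <= G z'.
Proof.
move=> z0 zz'; apply: lb_le_inf; first by apply: S_nonempty; exact: le_trans zz'.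
move=> a [y zy Va]; apply: ge_inf; first exact: S_has_lbound.
by exists y => //; exact: le_lt_trans zy.
Qed.

Let G_nondecreasing : nondecreasing_nonneg G.
Proof.
split; last exact: G_ge0.
by move=> x y; rewrite !in_itv/= !andbT => x0 y0; exact: G_le.
Qed.

Let G_upper z e : 0 <= z -> 0 < e -> \forall n \near \oo, V n z <= G z + e.
Proof.
move=> z0 e0; have [a [y [zy Va aG]]] := G_adherent z0 e0.
apply: filterS Va => n Vna; apply/ltW; apply: le_lt_trans aG.
by apply: le_trans Vna; rewrite (nondecreasing_nonneg_le (HV n))// ltW.
Qed.

(** With y the midpoint of w and z, [karamata_cauchy] makes V_m(z) + e an eventual upper bound of
    V_n(y) for each large m. As y > w, it belongs to [upper_values w]. *)
Let G_lower w z e : 0 <= w -> w < z -> 0 < e ->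
  \forall n \near \oo, G w <= V n z + e.
Proof.
move=> w0 wz e0; pose y := (w + z) / 2.
have wy : w < y by rewrite midf_lt.
have yz : y < z by rewrite midf_lt.
have y0 : 0 <= y by rewrite (le_trans w0)// ltW.
have cV k : exists a : R, laplace (V n) k.+1%:R @[n --> \oo] --> a%:E.
  by eexists; apply: tauber_laplace_cvg; rewrite ltr0n.
have [N NP] := karamata_cauchy HV
  (laplace_finite_rescaled rho HU r1 sl tauber_laplace_finite) cV y0 yz e0.
exists N => // m Nm; apply: ge_inf; first exact: S_has_lbound.
by exists y => //; exists N => // n Nn; exact: NP.
Qed.

Let G_right_continuous z : 0 < z -> G y @[y --> z^'+] --> G z.
Proof.
move=> z0; apply/cvgrPdist_lt => e e0.
have [a [y [zy Va aG]]] := G_adherent (ltW z0) e0.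
exists (y - z) => /=; first by rewrite subr_gt0.
move=> w /= wyz zw; have wy : w < y.
  by move: wyz; rewrite distrC gtr0_norm ?subr_gt0// ltrD2r.
have w0 : 0 < w := lt_trans z0 zw.
have Gw : G w <= a by apply: ge_inf; [exact/S_has_lbound/ltW|exists y].
rewrite distrC ger0_norm ?subr_ge0 ?G_le// ?ltW// ltrBlDl.
exact: le_lt_trans aG.
Qed.

Let G_cvg z : 0 < z -> {for z, continuous G} -> V n z @[n --> \oo] --> G z.
Proof.
move=> z0 /cvgrPdist_lt cG; apply/cvgrPdist_lt => e e0.
have e2 : 0 < e / 2 by rewrite divr_gt0.
have [d/= d0 dP] := cG _ e2.
pose w := Num.max (z / 2) (z - d / 2).
have wz : w < z by rewrite gt_max; apply/andP; split; lra.
have w0 : 0 <= w by rewrite le_max; apply/orP; left; lra.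
have Gzw : `|G z - G w| < e / 2.
  apply: dP => /=; rewrite gtr0_norm ?subr_gt0//.
  by rewrite ltrBlDr -ltrBlDl lt_max; apply/orP; right; lra.
apply: filterS2 (G_upper (ltW z0) e2) (G_lower w0 wz e2) => n nu nl.
by move: Gzw; rewrite !ltr_norml => /andP[? ?]; apply/andP; split; lra.
Qed.

Let D := [set x : R | 0 < x /\ ~ {for x, continuous G}].
Let cD : countable D := right_continuous_discontinuity_countable G_right_continuous.

Let G_scale z : 0 < z -> G (r * z) = r `^ rho * G z.
Proof.
have rc1 x : 0 < x -> G (r * y) @[y --> x^'+] --> G (r * x).
  move=> x0; apply: right_continuous_scale => //.
  by apply: G_right_continuous; rewrite mulr_gt0.
have rc2 x : 0 < x -> r `^ rho * G y @[y --> x^'+] --> r `^ rho * G x.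
  by move=> x0; apply: cvgM; [exact: cvg_cst|exact: G_right_continuous].
pose D' := D `|` [set x | 0 < x /\ ~ {for x, continuous (fun y => G (r * y))}].
have cD' : countable D'.
  rewrite /D' -bigcup2E; apply: bigcup_countable => // -[|[|n]] _ //=.
  exact: right_continuous_discontinuity_countable.
have E x : 0 < x -> ~ D' x -> G (r * x) = r `^ rho * G x.
  move=> x0 /not_orP[/not_andP[//|/contrapT cx] /not_andP[//|/contrapT crx]].
  have rx0 : 0 < r * x by rewrite mulr_gt0.
  have H1 := G_cvg rx0 (continuous_scale r0 crx).
  have H2 : V n.+1 x * (c n.+1 / c n) @[n --> \oo] --> G x * r `^ rho.
    by apply: cvgM; [rewrite (cvg_shiftS (V ^~ x)); exact: G_cvg|exact: normingS_cvg].
  rewrite (mulrC (r `^ rho)); apply: (cvg_unique (@norm_hausdorff _ R) H1).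
  apply: cvg_trans H2; apply: near_eq_cvg; apply: nearW => n.
  rewrite /rescaled exprSr -mulrA.
  by field; rewrite !gt_eqF.
move=> z0; apply/eqP; rewrite eq_le; apply/andP; split.
  by apply: (right_continuous_le cD' rc1 rc2) => // x x0 nD; rewrite E.
by apply: (right_continuous_le cD' rc2 rc1) => // x x0 nD; rewrite E.
Qed.

(** A zero at z would spread to all r^k z by scaling and to the whole half-line by monotonicity. The
    transform at 1 would then vanish, whereas its value is q(1) > 0. *)
Let G_gt0 z : 0 < z -> 0 < G z.
Proof.
move=> z0; rewrite lt_neqAle G_ge0 ?ltW// andbT; apply/eqP => Gz.
have Gk k : G (r ^+ k * z) = 0.
  elim: k => [|k IH]; first by rewrite expr0 mul1r.
  by rewrite exprS -mulrA G_scale ?mulr_gt0// IH mulr0.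
have G0 x : 0 <= x -> G x = 0.
  move=> x0; have [k kP] := expn_unbounded (x / z) r1.
  apply/eqP; rewrite eq_le G_ge0// andbT -(Gk k) G_le// -ler_pdivrMr// ltW//.
have [|_ LG] := cvg_laplace HV G_nondecreasing tauber_subexponential cD _ ltr01.
  by move=> x x0 nD; apply: G_cvg => //; apply: contrapT => nc; apply: nD.
have LG0 : laplace G 1 = 0%E.
  apply: integral0_eq => x; rewrite /= in_itv/= andbT => x0.
  by rewrite G0// mulr0.
have : laplace G 1 = (1 `^ (- rho) * q 1 / 1)%:E.
  exact: (cvg_unique (@ereal_hausdorff R) LG (tauber_laplace_cvg ltr01)).
rewrite LG0 powR1 mul1r divr1 => E; have q1 : 0 = q 1 by apply: EFin_inj; rewrite -E.
by have := q0 (ltr01 : (0 : R) < 1); rewrite -q1 ltxx.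
Qed.

Definition tauber_fun z : R := G z / z `^ rho.

Lemma calP_tauber_fun : calP r tauber_fun.
Proof.
have rr := powR_gt0 rho r0.
(* For u in [1, r], G(u) lies between G(1) and G(r), and u^rho between 1 and r^rho. *)
apply: (@calP_of_bounds _ _ (G 1 / r `^ rho) (G r)) => //.
- by rewrite divr_gt0// G_gt0.
- move=> u /andP[u1 ur]; have u0 : 0 < u := lt_le_trans ltr01 u1.
  have ru1 : 1 <= u `^ rho by have := ler_powR u1 rho0; rewrite powRr0.
  have rur : u `^ rho <= r `^ rho by rewrite ge0_ler_powR ?nnegrE// ltW.
  have up := powR_gt0 rho u0; rewrite /tauber_fun; apply/andP; split.
    by apply: ler_pM; rewrite ?invr_ge0 ?powR_ge0 ?G_ge0 ?G_le// lef_pV2.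
  rewrite ler_pdivrMr// (@le_trans _ _ (G r))// ?G_le// ?(ltW u0)//.
  by rewrite ler_peMr// G_ge0// ltW.
- move=> x x0; apply: cvgM; first exact: G_right_continuous.
  apply: cvgV; first by rewrite gt_eqF// powR_gt0.
  by apply: cvg_at_right_filter; exact: continuous_powR.
- move=> x x0; rewrite /tauber_fun (mulrC x) G_scale// powRM ?ltW//.
  by have := powR_gt0 rho x0; move: (x `^ rho) => y y0; field; rewrite !gt_eqF.
Qed.

Lemma tauber_growth : log_periodic_growth U l r rho tauber_fun.
Proof.
move=> z [z0 cz]; apply/(growth_rescaled U rho r1 sl) => //.
have zr := powR_gt0 rho z0.
rewrite /tauber_fun mulrCA mulfV ?gt_eqF// mulr1; apply: G_cvg => //.
have E x : 0 < x -> tauber_fun x * x `^ rho = G x.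
  by move=> x0; rewrite /tauber_fun divfK// gt_eqF// powR_gt0.
rewrite /prop_for /continuous_at -E//.
apply: (cvg_trans _ (cvgM cz (@continuous_powR _ rho _ z0))).
apply: near_eq_cvg; near=> x; rewrite /= E//.
by near: x; exact: lt_nbhsr.
Unshelve. all: by end_near. Qed.

End Tauberian.

Theorem theorem1 (R : realType) (U : R -> R) (rho r : R) (l : R -> R)
    (U_nd : {in `[0, +oo[ &, {homo U : x y / x <= y}})
    (U_ge0 : forall x, 0 <= x -> 0 <= U x)
    (rho_ge0 : 0 <= rho) (r_gt1 : 1 < r) (l_sv : slowly_varying l) :
  [/\ (exists p, calP r p /\ log_periodic_growth U l r rho p) <->
      (exists q, calP r q /\ log_periodic_laplace U l rho q),
      (forall p q : R -> R,
         calP r p -> log_periodic_growth U l r rho p ->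
         calP r q -> log_periodic_laplace U l rho q ->
         [/\ calP_rho r rho p,
             calQ_rho r rho q,
             0 < rho -> forall s, 0 < s -> (q s)%:E = opA rho p s
           & rho = 0 -> forall s, 0 < s -> p s = q s])
    & (forall p : R -> R,
         calP r p -> log_periodic_growth U l r rho p ->
         (forall z, 0 < z -> {for z, continuous p}) ->
         U x / (x `^ rho * l x * p x) @[x --> +oo] --> (1 : R))].
Proof.
have HU : nondecreasing_nonneg U by split; [exact: U_nd|exact: U_ge0].
split.
- split=> [[p [Hp Hg]]|[q [Hq Hl]]].
    exists (abel_fun rho p); split.
      exact: (calP_abel_fun HU rho_ge0 r_gt1 l_sv Hp Hg).
    exact: (log_periodic_laplace_abel_fun HU r_gt1 l_sv Hp Hg).
  exists (tauber_fun U l rho r); split.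
    exact: (calP_tauber_fun HU rho_ge0 r_gt1 l_sv Hq Hl).
  exact: (tauber_growth HU r_gt1 l_sv Hq Hl).
- move=> p q Hp Hg Hq Hl.
  (* As [p] already produces [abel_fun] in (b), uniqueness identifies every admissible [q] with it,
     and the claims on [q] become claims on [abel_fun]. *)
  have qE s : 0 < s -> q s = abel_fun rho p s.
    exact: (abel_fun_unique HU r_gt1 l_sv Hp Hg Hq Hl).
  split.
  + exact: (growth_calP_rho HU r_gt1 l_sv Hp Hg).
  + split; [by case: Hq| |by case: Hq].
    apply: (completely_monotone_laplace
      (limit_fun_nondecreasing HU r_gt1 l_sv Hp Hg)
      (limit_fun_finite HU r_gt1 l_sv Hp Hg)) => s s0.
    by rewrite qE// (abel_fun_stieltjes HU r_gt1 l_sv Hp Hg).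
  + move=> rho_gt0 s s0; rewrite qE//.
    exact: (opA_abel_fun HU r_gt1 l_sv Hp Hg).
  + move=> rho_eq0 s s0; rewrite qE//.
    by rewrite (abel_fun_constant HU r_gt1 l_sv Hp Hg).
- move=> p Hp Hg cp; exact: (growth_continuous HU r_gt1 l_sv Hp Hg cp).
Qed.
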